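(* Let $1<p<\infty$. Then the Banach spaces $\ell^{p,\infty}$, $L^{p,\infty}[0,1]$ and $L^{p,\infty}[0,\infty)$ are pairwise isomorphic (as Banach spaces, i.e. linearly homeomorphic).
   Context: All scalars are real. For a measure space $(\Omega,\Sigma,\mu)$, $1<p<\infty$ and $q=p/(p-1)$, the weak $L^p$ space $L^{p,\infty}(\Omega,\Sigma,\mu)$ is the space of all (classes modulo a.e. equality of) $\Sigma$-measurable functions $f$ such that $\{\omega:|f(\omega)|>0\}$ is $\sigma$-finite and $$\|f\|:=\sup_B\frac{\int_B|f|\,d\mu}{\mu(B)^{1/q}}<\infty,$$ the supremum being over all measurable $B$ with $0<\mu(B)<\infty$; it is normed by $\|\cdot\|$. For a real interval $I$, $L^{p,\infty}(I)$ is this space for $I$ with Lebesgue measure. $\ell^{p,\infty}$ is this space for $\mathbb{N}$ with counting measure. *)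

(* Defs.v *)
From HB Require Import structures.
From mathcomp Require Import all_boot all_order all_algebra.
From mathcomp Require Import all_classical all_reals all_analysis.
From mathcomp Require Import measurable_realfun.

Set Implicit Arguments.
Unset Strict Implicit.
Unset Printing Implicit Defensive.

Import Order.TTheory GRing.Theory Num.Theory.
Import numFieldNormedType.Exports.

Local Open Scope classical_set_scope.
Local Open Scope ring_scope.

Section WeakNorm.
Context d (T : measurableType d) (R : realType).
Variables (mu : {measure set T -> \bar R}) (p : R).
Local Open Scope ereal_scope.

(* The supremum is taken in [0, +oo], so that it is 0 when there is no set of
   positive finite measure. *)
Definition weak_norm (f : T -> R) : \bar R :=
  let q := (p / (p - 1))%R in
  ereal_sup (0 |` [set (\int[mu]_(x in B) `|f x|%:E) / (mu B) `^ q^-1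
                  | B in [set B | measurable B /\ 0 < mu B < +oo]]).

Lemma weak_norm_ge0 f : 0 <= weak_norm f.
Proof. by apply: ereal_sup_ubound; left. Qed.

Lemma weak_norm_ub f B : measurable B -> 0 < mu B < +oo ->
  (\int[mu]_(x in B) `|f x|%:E) / (mu B) `^ (p / (p - 1))^-1 <= weak_norm f.
Proof. by move=> mB B0; apply: ereal_sup_ubound; right; exists B. Qed.

Lemma weak_norm_le f M : 0 <= M ->
  (forall B, measurable B -> 0 < mu B < +oo ->
    (\int[mu]_(x in B) `|f x|%:E) / (mu B) `^ (p / (p - 1))^-1 <= M) ->
  weak_norm f <= M.
Proof.
move=> M0 H; apply: ge_ereal_sup => _ [->//|[B [mB B0] <-]].
exact: H.
Qed.

Lemma weight_EFin r B : 0 < mu B < +oo ->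
  exists2 c : R, (0 < c)%R & ((mu B) `^ r)^-1 = c%:E.
Proof.
case/andP => B0 Boo.
have := poweR_gt0 r B0.
have : (mu B) `^ r \is a fin_num.
  by apply: fin_num_poweR; rewrite ge0_fin_numE// ltW.
case: (_ `^ _) => // c _; rewrite lte_fin => c0.
by exists c^-1%R; rewrite ?invr_gt0// inver gt_eqF.
Qed.

Let m B (h : {mfun T >-> R}) : measurable B ->
  measurable_fun B (fun x => `|h x|%:E).
Proof.
move=> mB; apply/measurable_EFinP; apply: measurableT_comp => //.
exact: measurable_funS (@measurable_funPT _ _ _ _ h).
Qed.

Lemma weak_normD (f g : {mfun T >-> R}) :
  weak_norm (f \+ g)%R <= weak_norm f + weak_norm g.
Proof.
apply: weak_norm_le => [|B mB B0]; first by rewrite adde_ge0// weak_norm_ge0.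
apply: le_trans (leeD (weak_norm_ub f mB B0) (weak_norm_ub g mB B0)).
have [c c0 ->] := weight_EFin (p / (p - 1))^-1 B0.
rewrite -ge0_muleDl; try exact: integral_ge0.
rewrite lee_pmul2r// -ge0_integralD//; try exact: m.
apply: ge0_le_integral => //.
- exact: (m (f + g : {mfun T >-> R})%R).
- by apply: emeasurable_funD; exact: m.
- by move=> x _; rewrite -EFinD lee_fin ler_normD.
Qed.

Let weak_normZ_le a (f : {mfun T >-> R}) :
  weak_norm (fun x => a * f x)%R <= `|a|%:E * weak_norm f.
Proof.
apply: weak_norm_le => [|B mB B0]; first by rewrite mule_ge0// weak_norm_ge0.
apply: le_trans (lee_pmul _ _ (lexx _) (weak_norm_ub f mB B0)) => //; last first.
  have [c c0 ->] := weight_EFin (p / (p - 1))^-1 B0.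
  by rewrite mule_ge0// ?integral_ge0// lee_fin ltW.
rewrite muleA lee_wpmul2r//.
  by have [c c0 ->] := weight_EFin (p / (p - 1))^-1 B0; rewrite lee_fin ltW.
rewrite -ge0_integralZl_EFin//; last first.
  exact: m.
by under eq_integral do rewrite normrM EFinM.
Qed.

Lemma weak_normZ a (f : {mfun T >-> R}) :
  weak_norm (fun x => a * f x)%R = `|a|%:E * weak_norm f.
Proof.
apply/eqP; rewrite eq_le weak_normZ_le/=.
have [->|a0] := eqVneq a 0%R; first by rewrite normr0 mul0e weak_norm_ge0.
have := weak_normZ_le a^-1 (a *: f : {mfun T >-> R})%R.
rewrite [X in weak_norm X <= _](_ : _ = f :> (T -> R)); last first.
  by apply/funext => x; rewrite mulrA mulVf// mul1r.
move=> /(lee_pmul _ _ (lexx `|a|%:E)) /le_trans; apply => //.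
  exact: weak_norm_ge0.
by rewrite muleA -EFinM -normrM mulfV// normr1 mul1e.
Qed.

Lemma weak_norm_ae_eq (f g : {mfun T >-> R}) :
  f = g %[ae mu] -> weak_norm f = weak_norm g.
Proof.
move=> fg; congr ereal_sup; congr (_ |` _).
apply: eq_imagel => B [mB B0]; congr (_ / _).
apply: ge0_ae_eq_integral => //; [exact: m|exact: m|].
apply: (@ae_eq_subset _ _ _ _ _ setT) => //.
exact: (ae_eq_comp (fun r => `|r|%:E)).
Qed.

Lemma sigma_finite_sub (A B : set T) : measurable A -> A `<=` B ->
  sigma_finite B mu -> sigma_finite A mu.
Proof.
move=> mA AB [F BF HF]; exists (fun n => A `&` F n).
  by rewrite -setI_bigcupr -BF; apply/esym/setIidPl.
move=> n; have [mF Foo] := HF n; split; first exact: measurableI.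
by apply: le_lt_trans Foo; apply: le_measure; rewrite ?inE//; exact: measurableI.
Qed.

Lemma sigma_finiteU (A B : set T) :
  sigma_finite A mu -> sigma_finite B mu -> sigma_finite (A `|` B) mu.
Proof.
move=> [F -> HF] [G -> HG]; exists (fun n => F n `|` G n).
  by rewrite bigcupU.
move=> n; have [mF Foo] := HF n; have [mG Goo] := HG n.
split; first exact: measurableU.
by apply: le_lt_trans (measureU2 _ mF mG) _ => //; rewrite lte_add_pinfty.
Qed.

Lemma weak_norm_eq0 (f : {mfun T >-> R}) :
  sigma_finite [set x | (0 < `|f x|)%R] mu -> weak_norm f = 0 ->
  f = cst 0%R %[ae mu].
Proof.
move=> [F fF HF] f0.
have F0 n : mu (F n) = 0.
  have [mF Foo] := HF n.
  apply/eqP; rewrite -measure_le0 leNgt; apply/negP => Fn0.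
  have B0 : 0 < mu (F n) < +oo by rewrite Fn0.
  have := weak_norm_ub f mF B0.
  have [c c0 ->] := weight_EFin (p / (p - 1))^-1 B0.
  rewrite f0 pmule_lle0//.
  have mf : measurable_fun (F n) (EFin \o f).
    apply/measurable_EFinP.
    exact: measurable_funS (@measurable_funPT _ _ _ _ f).
  move=> int_le0.
  have int0 : \int[mu]_(x in F n) `|(EFin \o f) x| = 0.
    by apply/eqP; rewrite eq_le int_le0/= integral_ge0.
  have [+ _] := ae_eq_integral_abs mu mF mf.
  move=> /(_ int0) [N [mN N0 FN]].
  move: Fn0; rewrite ltNge => /negP; apply; rewrite -N0.
  apply: le_measure; rewrite ?inE//; apply: subset_trans FN => x Fx /= /(_ Fx).
  move=> [fx0].
  have : [set x | (0 < `|f x|)%R] x by rewrite fF; exists n.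
  by rewrite /= fx0 normr0 ltxx.
apply: (@negligibleS _ _ _ _ (\bigcup_n F n)).
  rewrite -fF => x /= H; rewrite normr_gt0; apply/eqP => fx0.
  by apply: H.
apply: negligible_bigcup => n; apply/negligibleP; last exact: F0.
by have [] := HF n.
Qed.

End WeakNorm.

Section WeakLpFun.
Context d (T : measurableType d) (R : realType).
Variables (mu : {measure set T -> \bar R}) (p : R).

Definition weakLp_pred : {pred {mfun T >-> R}} := fun f =>
  `[< sigma_finite [set x | 0 < `|f x|] mu /\ (weak_norm mu p f < +oo)%E >].

Lemma measurable_supp (f : {mfun T >-> R}) :
  measurable [set x | 0 < `|f x|].
Proof.
have mf : measurable_fun setT (fun x => `|f x|) by exact: measurableT_comp.
have := mf measurableT `]0, +oo[%classic (measurable_itv _).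
rewrite setTI; congr measurable; apply/seteqP; split => x /=;
  by rewrite in_itv/= andbT.
Qed.

Let weakLp_submod_closed : submod_closed weakLp_pred.
Proof.
split.
  apply/asboolP; split.
    exists (fun=> set0) => [|n]; last by rewrite measure0.
    by rewrite bigcup0//; apply/seteqP; split => x //=; rewrite normr0 ltxx.
  have := weak_normZ mu p 0 0.
  rewrite normr0 mul0e.
  by under eq_fun do rewrite mul0r; move=> ->.
move=> a f g /asboolP[sf nf] /asboolP[sg ng]; apply/asboolP; split.
  apply: sigma_finite_sub (sigma_finiteU sf sg); first exact: measurable_supp.
  move=> x /=; rewrite !normr_gt0.
  have [fx0|] := eqVneq (f x) 0; last by left.
  have [gx0|] := eqVneq (g x) 0; last by right.
  move=> /eqP; case; change (a * f x + g x = 0).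
  by rewrite fx0 gx0 mulr0 addr0.
apply: (le_lt_trans (weak_normD mu p (a *: f) g)).
rewrite lte_add_pinfty//.
have -> := weak_normZ mu p a f.
by rewrite lte_mul_pinfty.
Qed.

HB.instance Definition _ := GRing.isSubmodClosed.Build R {mfun T >-> R}
  weakLp_pred weakLp_submod_closed.

Record weakLp_fun := WeakLpFun {
  weakLp_fun_val :> {mfun T >-> R};
  _ : weakLp_fun_val \in weakLp_pred }.

HB.instance Definition _ := [isSub of weakLp_fun for weakLp_fun_val].
HB.instance Definition _ := [Choice of weakLp_fun by <:].
HB.instance Definition _ := [SubChoice_isSubLmodule of weakLp_fun by <:].

Definition weakLp_ae_eq : rel weakLp_fun := fun f g => `[< f = g %[ae mu] >].

Let weakLp_ae_eq_equiv : equiv_class_of weakLp_ae_eq.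
Proof.
split=> [f|f g|g f h].
- by apply/asboolP; exact: ae_eq_refl.
- by apply/asboolP/asboolP; exact: ae_eq_sym.
- by move=> /asboolP fg /asboolP gh; apply/asboolP; exact: ae_eq_trans fg gh.
Qed.

Canonical weakLp_ae_eq_rel := EquivRelPack weakLp_ae_eq_equiv.

Lemma weakLp_funD (f g : weakLp_fun) x : (f + g) x = f x + g x.
Proof. by []. Qed.

Lemma weakLp_funN (f : weakLp_fun) x : (- f) x = - f x.
Proof. by []. Qed.

Lemma weakLp_funZ a (f : weakLp_fun) x : (a *: f) x = a * f x.
Proof. by []. Qed.

Local Open Scope quotient_scope.

(* Meaningful for 1 < p; the construction does not need this hypothesis. *)
Definition weakLp : Type := {eq_quot weakLp_ae_eq}.
HB.instance Definition _ := Choice.on weakLp.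
HB.instance Definition _ := EqQuotient.on weakLp.

Local Notation Q := weakLp.
Implicit Types (f g : weakLp_fun) (u v w : Q).

Lemma weakLp_eqP f g : \pi_Q f = \pi_Q g <-> f = g %[ae mu].
Proof.
by split => [/eqmodP/asboolP//|fg]; apply/eqmodP/asboolP.
Qed.

Lemma weakLp_reprK f : repr (\pi_Q f) = f %[ae mu].
Proof. by apply/weakLp_eqP; rewrite reprK. Qed.

Let piP u : exists f, u = \pi_Q f.
Proof. by exists (repr u); rewrite reprK. Qed.

Definition weakLp_zero : Q := \pi_Q (0 : weakLp_fun).
Definition weakLp_add u v : Q := \pi_Q (repr u + repr v).
Definition weakLp_opp u : Q := \pi_Q (- repr u).
Definition weakLp_scale (a : R) u : Q := \pi_Q (a *: repr u).

Let piD f g : weakLp_add (\pi_Q f) (\pi_Q g) = \pi_Q (f + g).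
Proof.
apply/weakLp_eqP; have := weakLp_reprK f; apply: filterS2 (weakLp_reprK g).
by move=> x /(_ I) gE /(_ I) fE _; rewrite !weakLp_funD gE fE.
Qed.

Let piN f : weakLp_opp (\pi_Q f) = \pi_Q (- f).
Proof.
apply/weakLp_eqP; apply: filterS (weakLp_reprK f).
by move=> x /(_ I) fE _; rewrite !weakLp_funN fE.
Qed.

Let piZ a f : weakLp_scale a (\pi_Q f) = \pi_Q (a *: f).
Proof.
apply/weakLp_eqP; apply: filterS (weakLp_reprK f).
by move=> x /(_ I) fE _; rewrite !weakLp_funZ fE.
Qed.

Let addA : associative weakLp_add.
Proof.
move=> u v w; have [f ->] := piP u; have [g ->] := piP v.
by have [h ->] := piP w; rewrite !piD addrA.
Qed.

Let addC : commutative weakLp_add.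
Proof. by move=> u v; have [f ->] := piP u; have [g ->] := piP v; rewrite !piD addrC. Qed.

Let add0 : left_id weakLp_zero weakLp_add.
Proof. by move=> u; have [f ->] := piP u; rewrite piD add0r. Qed.

Let addN : left_inverse weakLp_zero weakLp_opp weakLp_add.
Proof. by move=> u; have [f ->] := piP u; rewrite piN piD addNr. Qed.

HB.instance Definition _ := GRing.isZmodule.Build Q addA addC add0 addN.

Let scaleA a b u : weakLp_scale a (weakLp_scale b u) = weakLp_scale (a * b) u.
Proof. by have [f ->] := piP u; rewrite !piZ scalerA. Qed.

Let scale1 : left_id 1 weakLp_scale.
Proof. by move=> u; have [f ->] := piP u; rewrite piZ scale1r. Qed.

Let scaleDr : right_distributive weakLp_scale +%R.
Proof.
move=> a u v; have [f ->] := piP u; have [g ->] := piP v.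
by rewrite /+%R/= !(piD, piZ) scalerDr.
Qed.

Let scaleDl u : {morph weakLp_scale^~ u : a b / a + b}.
Proof.
move=> a b; have [f ->] := piP u.
by rewrite [in RHS]/+%R/= !(piD, piZ) scalerDl.
Qed.

HB.instance Definition _ :=
  GRing.Zmodule_isLmodule.Build R Q scaleA scale1 scaleDr scaleDl.

Lemma weakLp_piD f g : \pi_Q (f + g) = \pi_Q f + \pi_Q g.
Proof. by rewrite -piD. Qed.

Lemma weakLp_piZ a f : \pi_Q (a *: f) = a *: \pi_Q f.
Proof. by rewrite -piZ. Qed.

Definition weakLp_norm u : R := fine (weak_norm mu p (repr u)).

Lemma weak_norm_fin_num f : weak_norm mu p f \is a fin_num.
Proof.
case: f => f /= /asboolP[_ nf].
by rewrite ge0_fin_numE// weak_norm_ge0.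
Qed.

Let normE f : (weakLp_norm (\pi_Q f))%:E = weak_norm mu p f.
Proof.
by rewrite fineK ?weak_norm_fin_num//; exact/weak_norm_ae_eq/weakLp_reprK.
Qed.

Let normD u v : weakLp_norm (u + v) <= weakLp_norm u + weakLp_norm v.
Proof.
have [f ->] := piP u; have [g ->] := piP v.
by rewrite -weakLp_piD -lee_fin EFinD !normE weak_normD.
Qed.

Let normZ a u : weakLp_norm (a *: u) = `|a| * weakLp_norm u.
Proof.
have [f ->] := piP u; apply: EFin_inj.
by rewrite -weakLp_piZ EFinM !normE -weak_normZ.
Qed.

Let norm0 u : weakLp_norm u = 0 -> u = 0.
Proof.
have [f ->] := piP u; move=> n0.
have f0 : weak_norm mu p f = 0%E by rewrite -normE n0.
have /asboolP[sf _] := valP f.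
by apply/weakLp_eqP; exact: weak_norm_eq0 sf f0.
Qed.

HB.instance Definition _ := Lmodule_isNormed.Build R Q normD normZ norm0.

Lemma weakLp_normE f : `|\pi_Q f|%:E = weak_norm mu p f.
Proof. exact: normE. Qed.

End WeakLpFun.

Section IntervalMeasure.
Context (R : realType) (I : interval R) (I0 : [set` I] !=set0).

(* [I0] is only needed because measurable types are pointed. *)
Definition itv_sub of [set` I] !=set0 : Type := {x : R | x \in I}.
HB.instance Definition _ := Choice.on (itv_sub I0).
HB.instance Definition _ := isPointed.Build (itv_sub I0)
  (exist _ (sval (cid I0)) (svalP (cid I0))).

Definition itv_val (x : itv_sub I0) : R := sval x.

(* The sigma-algebra is the trace on I of the Borel sets of R. Every Lebesgue
   measurable function is a.e. equal to a Borel one, so this gives the same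
   space of classes as the Lebesgue sigma-algebra. *)
Definition itvType := g_sigma_algebra_preimageType itv_val.

HB.instance Definition _ := Measurable.on itvType.

Definition itv_lebesgue_measure (A : set itvType) : \bar R :=
  lebesgue_measure (itv_val @` A).

Let mu := itv_lebesgue_measure.

Lemma itv_val_inj : injective itv_val.
Proof. exact: val_inj. Qed.

Lemma measurable_itv_val (A : set itvType) :
  measurable A -> measurable (itv_val @` A).
Proof.
case=> B mB <-; rewrite setTI.
have -> : itv_val @` (itv_val @^-1` B) = B `&` [set` I].
  apply/seteqP; split=> [_ [x Bx <-]|x [Bx Ix]].
    by split => //; exact: (svalP x).
  by exists (exist _ x Ix).
by apply: measurableI => //; exact: measurable_itv.
Qed.

Let mu0 : mu set0 = 0%E.
Proof. by rewrite /mu /itv_lebesgue_measure image_set0 measure0. Qed.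

Let mu_ge0 A : (0 <= mu A)%E.
Proof. exact: measure_ge0. Qed.

Let mu_sigma_additive : semi_sigma_additive mu.
Proof.
move=> F mF tF mUF; rewrite /mu /itv_lebesgue_measure image_bigcup.
apply: measure_semi_sigma_additive.
- by move=> i; exact: measurable_itv_val.
- apply/trivIsetP => i j _ _ ij; rewrite -subset0 => x [[y Fy <-]].
  move=> [z Fz /itv_val_inj zy]; move: Fz; rewrite zy => Fz.
  by move/trivIsetP : tF => /(_ i j Logic.I Logic.I ij)/seteqP[/(_ y (conj Fy Fz))].
- by rewrite -image_bigcup; exact: measurable_itv_val.
Qed.

HB.instance Definition _ := isMeasure.Build _ _ _ itv_lebesgue_measure
  mu0 mu_ge0 mu_sigma_additive.

End IntervalMeasure.

Definition linearly_homeomorphic (R : realType) (V W : normedModType R) : Prop :=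
  exists (f : {linear V -> W}) (g : W -> V),
    [/\ cancel f g, cancel g f, continuous f & continuous g].

Section Spaces.
Variable R : realType.

Lemma itv01_neq0 : [set` `[0 : R, 1]] !=set0.
Proof. by exists 0; rewrite /= in_itv/= lexx ler01. Qed.

Lemma itv0y_neq0 : [set` `[0 : R, +oo[] !=set0.
Proof. by exists 0; rewrite /= in_itv/= lexx. Qed.

Definition weak_ell (p : R) : normedModType R := weakLp (@counting nat R) p.

Definition weakLp_itv (I : interval R) (I0 : [set` I] !=set0) (p : R) :
  normedModType R := weakLp (@itv_lebesgue_measure R I I0) p.

End Spaces.

(* Main.v *)
(* By Pelczynski's decomposition method it is enough that each of the three spaces
   is isomorphic to its square and that any two of them embed complementably in
   each other.  Squares and the passage from [0,1] to [0,oo) come from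
   compositions with piecewise affine maps.

   The essential point is that L[0,oo) is complemented in l, and l in L[0,1].
   For f on the source, let E_j f be its averages over the N_j atoms of level j
   (dyadic intervals of length 2^-j in [0,2^j), say).  Place all these averages,
   normalised according to the ratio of the measures, on disjoint blocks of the
   target, the blocks of level j having a common measure a_j.  If (a_j) is
   lacunary enough with respect to (N_j), this spreading of f is bounded for the
   weak norm.  It has a bounded left inverse: a function g on the target defines,
   level by level, set functions S |-> nu_j(S) with |nu_j(S)| <= C mu(S)^(1/q), and
   their limit along an ultrafilter is a finitely additive set function with the
   same bound, hence (Radon-Nikodym) the integral of a weak L^p function. *)
Require Import Defs.
From HB Require Import structures.
From mathcomp Require Import all_boot all_order all_algebra.
From mathcomp Require Import all_classical all_reals all_analysis.
From mathcomp Require Import measurable_realfun.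
From mathcomp Require Import ring lra.

Set Implicit Arguments.
Unset Strict Implicit.
Unset Printing Implicit Defensive.

Import Order.TTheory GRing.Theory Num.Theory.
Import numFieldNormedType.Exports.

Local Open Scope classical_set_scope.
Local Open Scope ring_scope.

(** * Pelczynski's decomposition *)

Section Decomposition.
Context {R : realType}.
Implicit Types U V W : normedModType R.

(** The obstacle is that a nonatomic space has to sit complementably in an atomic one, which is
    impossible for [L^p] and [ell^p] unless p = 2. A weak norm tests one height at a time: at height
    [s] only the levels with [a j <= (K / s)^p] contribute, and lacunarity makes their total
    comparable to a single one. Hence infinitely many levels of averages of [f] can be superposed,
    whereas in [L^p] each of them would add its full norm.

    No single level determines [f], but on a set that is a union of atoms of every fine level the
    gathered values are eventually constant, so a limit over the levels recovers the integrals of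
    [f]. For a general [g] nothing converges, whence the ultrafilter. It preserves only finite
    additivity; countable additivity returns because the bound by the power 1/q > 0 of the measure
    forces continuity at the empty set. *)

Definition complemented V W : Prop :=
  exists (i : {linear V -> W}) (r : {linear W -> V}),
    [/\ continuous i, continuous r & cancel i r].

Lemma linearly_homeomorphic_sym V W :
  linearly_homeomorphic V W -> linearly_homeomorphic W V.
Proof.
move=> [f [g [fK gK cf cg]]].
have lg : linear g.
  by move=> a u v; apply: (can_inj fK); rewrite gK linearP !gK.
pose G := GRing.isLinear.Build _ _ _ _ g lg.
pose g' : {linear W -> V} := HB.pack g G.
by exists g', f.
Qed.

Lemma linearly_homeomorphic_trans U V W :
  linearly_homeomorphic U V -> linearly_homeomorphic V W ->
  linearly_homeomorphic U W.
Proof.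
move=> [f [g [fK gK cf cg]]] [f' [g' [fK' gK' cf' cg']]].
exists (f' \o f), (g \o g'); split.
- by move=> x /=; rewrite fK' fK.
- by move=> x /=; rewrite gK gK'.
- by move=> x; apply: continuous_comp; [exact: cf|exact: cf'].
- by move=> x; apply: continuous_comp; [exact: cg'|exact: cg].
Qed.

Lemma linearly_homeomorphic_prodC V W :
  linearly_homeomorphic (V * W)%type (W * V)%type.
Proof.
have sw (A B : normedModType R) : continuous (fun x : A * B => (x.2, x.1)).
  by move=> x; apply: cvg_pair; [exact: cvg_snd|exact: cvg_fst].
have lf : linear (fun x : V * W => (x.2, x.1)) by [].
pose F := GRing.isLinear.Build _ _ _ _ _ lf.
pose f : {linear (V * W)%type -> (W * V)%type} :=
  HB.pack (fun x : V * W => (x.2, x.1)) F.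
by exists f, (fun x => (x.2, x.1)); split; [case|case|exact: sw|exact: sw].
Qed.

Lemma complemented_trans U V W :
  complemented U V -> complemented V W -> complemented U W.
Proof.
move=> [i [r [ci cr ir]]] [i' [r' [ci' cr' ir']]].
exists (i' \o i), (r \o r'); split.
- by move=> x; apply: continuous_comp; [exact: ci|exact: ci'].
- by move=> x; apply: continuous_comp; [exact: cr'|exact: cr].
- by move=> x /=; rewrite ir' ir.
Qed.

Lemma linearly_homeomorphic_complemented U V :
  linearly_homeomorphic U V -> complemented U V.
Proof.
move=> uv; have [f [g [fK gK cf cg]]] := linearly_homeomorphic_sym uv.
have [f' [g' [fK' gK' cf' cg']]] := uv.
have lg : linear g.
  by move=> a u v; apply: (can_inj fK); rewrite gK linearP !gK.
pose G := GRing.isLinear.Build _ _ _ _ g lg.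
pose g1 : {linear U -> V} := HB.pack g G.
by exists g1, f.
Qed.

(* [W = V + ker r] and [V] absorbs a further copy of itself. *)
Lemma square_absorb V W : complemented V W ->
  linearly_homeomorphic V (V * V)%type -> linearly_homeomorphic W (V * W)%type.
Proof.
move=> [i [r [ci cr ir]]] sq.
have [s [t [sK tK cs ct]]] := sq.
(* [w] is the sum of [i (r w)] and a part in the kernel of [r]. The isomorphism with the square cuts
   [r w] in two; the first half is split off, the second goes back into [W]. *)
pose F w : V * W := ((s (r w)).1, i (s (r w)).2 + (w - i (r w))).
have lF : linear F.
  move=> a u v; rewrite /F !linearP/=; congr pair.
  transitivity (a *: (i (s (r u)).2 + (u - i (r u))) +
    (i (s (r v)).2 + (v - i (r v)))) => //.
  by rewrite !scalerDr scalerN [RHS]addrACA; congr (_ + _); rewrite addrACA.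
pose G (x : V * W) : W := i (t (x.1, r x.2)) + (x.2 - i (r x.2)).
pose FL := GRing.isLinear.Build _ _ _ _ F lF.
pose F' : {linear W -> (V * W)%type} := HB.pack F FL.
exists F', G; split.
- move=> w; rewrite /G/= linearD linearB !ir subrr addr0 -surjective_pairing.
  by rewrite sK addrAC subrr add0r addrCA subrr addr0.
- move=> [v w]; rewrite /= /F /G/= linearD linearB !ir subrr addr0 tK/=.
  by congr pair; rewrite addrAC subrr add0r addrCA subrr addr0.
- move=> w; apply: cvg_pair => /=.
    apply: (continuous_comp (f := s \o r) (g := fst)); last exact: cvg_fst.
    by apply: continuous_comp; [exact: cr|exact: cs].
  apply: cvgD.
    apply: (continuous_comp (f := snd \o (s \o r)) (g := i)); last exact: ci.
    apply: (continuous_comp (f := s \o r) (g := snd)); last exact: cvg_snd.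
    by apply: continuous_comp; [exact: cr|exact: cs].
  apply: cvgB; first exact: cvg_id.
  by apply: (continuous_comp (f := r) (g := i)); [exact: cr|exact: ci].
- move=> x; apply: cvgD.
    apply: (continuous_comp (f := t \o (fun x => (x.1, r x.2))) (g := i));
      last exact: ci.
    apply: (continuous_comp (g := t)); last exact: ct.
    apply: cvg_pair; first exact: cvg_fst.
    by apply: (continuous_comp (f := snd) (g := r)); [exact: cvg_snd|exact: cr].
  apply: cvgB; first exact: cvg_snd.
  apply: (continuous_comp (f := r \o snd) (g := i)); last exact: ci.
  by apply: (continuous_comp (f := snd) (g := r)); [exact: cvg_snd|exact: cr].
Qed.

(** Each space absorbs the other, so both are isomorphic to [V * W]. *)
Lemma decomposition V W : complemented V W -> complemented W V ->
  linearly_homeomorphic V (V * V)%type -> linearly_homeomorphic W (W * W)%type ->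
  linearly_homeomorphic V W.
Proof.
move=> VW WV V2 W2.
apply: linearly_homeomorphic_trans (square_absorb WV W2) _.
apply: linearly_homeomorphic_trans (linearly_homeomorphic_prodC _ _) _.
exact/linearly_homeomorphic_sym/square_absorb.
Qed.

Lemma square_transfer V W : linearly_homeomorphic V W ->
  linearly_homeomorphic V (V * V)%type -> linearly_homeomorphic W (W * W)%type.
Proof.
move=> vw; have [f [g [fK gK cf cg]]] := vw => v2.
apply: linearly_homeomorphic_trans (linearly_homeomorphic_sym vw) _.
apply: linearly_homeomorphic_trans v2 _.
pose F (x : V * V) : W * W := (f x.1, f x.2).
have lF : linear F by move=> a u v; rewrite /F !linearP.
pose FL := GRing.isLinear.Build _ _ _ _ F lF.
pose F' : {linear (V * V)%type -> (W * W)%type} := HB.pack F FL.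
exists F', (fun x => (g x.1, g x.2)); split.
- by move=> [a b]; rewrite /= !fK.
- by move=> [a b]; rewrite /= /F/= !gK.
- move=> x; apply: cvg_pair.
    by apply: (continuous_comp (f := fst) (g := f)); [exact: cvg_fst|exact: cf].
  by apply: (continuous_comp (f := snd) (g := f)); [exact: cvg_snd|exact: cf].
- move=> x; apply: cvg_pair.
    by apply: (continuous_comp (f := fst) (g := g)); [exact: cvg_fst|exact: cg].
  by apply: (continuous_comp (f := snd) (g := g)); [exact: cvg_snd|exact: cg].
Qed.

Lemma square_of_linear V (A0 A1 B0 B1 : {linear V -> V}) :
  continuous A0 -> continuous A1 -> continuous B0 -> continuous B1 ->
  (forall u, B0 (A0 u) + B1 (A1 u) = u) ->
  (forall u v, A0 (B0 u + B1 v) = u) -> (forall u v, A1 (B0 u + B1 v) = v) ->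
  linearly_homeomorphic V (V * V)%type.
Proof.
move=> cA0 cA1 cB0 cB1 BA A0B A1B.
pose F u : V * V := (A0 u, A1 u).
have lF : linear F by move=> a u v; rewrite /F !linearP.
pose FL := GRing.isLinear.Build _ _ _ _ F lF.
pose F' : {linear V -> (V * V)%type} := HB.pack F FL.
exists F', (fun x => B0 x.1 + B1 x.2); split.
- by move=> u; exact: BA.
- by move=> [u v]; rewrite /= /F A0B A1B.
- by move=> u; apply: cvg_pair; [exact: cA0|exact: cA1].
- move=> x; apply: cvgD.
    by apply: (continuous_comp (f := fst) (g := B0)); [exact: cvg_fst|exact: cB0].
  by apply: (continuous_comp (f := snd) (g := B1)); [exact: cvg_snd|exact: cB1].
Qed.

End Decomposition.

(** * The weak norm and the distribution function *)

Section RealEstimates.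
Context {R : realType} (p : R).
Hypothesis p1 : 1 < p.
Local Notation q := (p / (p - 1)).

Lemma conj_invE : q^-1 = 1 - p^-1.
Proof.
have p0 : p != 0 by rewrite gt_eqF// (lt_trans _ p1).
by rewrite invf_div mulrBl divff// mul1r.
Qed.

Lemma conj_inv_gt0 : 0 < q^-1.
Proof. by rewrite conj_invE subr_gt0 invf_lt1// (lt_trans _ p1). Qed.

Lemma powR_conj (x : R) : 0 <= x -> x = x `^ p^-1 * x `^ q^-1.
Proof.
move=> x0; rewrite -powRD conj_invE addrC subrK ?powRr1//.
by rewrite oner_eq0.
Qed.

(** Dividing by [m^(1/q)] leaves [m^(1/p) <= K / s]. This turns an integral bound on a level set
    into a bound on its size, where [m] is a measure or a cardinality. *)
Lemma weak_bound_of_strong (m s K : R) : 0 <= m -> 0 < s -> 0 <= K ->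
  s * m <= K * m `^ q^-1 -> m <= (K / s) `^ p.
Proof.
move=> m0 s0 K0 H.
have p0 : 0 < p by rewrite (lt_trans _ p1).
have [->|mN0] := eqVneq m 0; first exact: powR_ge0.
have mgt0 : 0 < m by rewrite lt_neqAle eq_sym mN0.
have mp : m `^ p^-1 <= K / s.
  rewrite ler_pdivlMr// -(@ler_pM2r _ (m `^ q^-1)) ?powR_gt0//.
  by rewrite mulrAC -powR_conj// mulrC.
rewrite -[leLHS](_ : (m `^ p^-1) `^ p = m); last first.
  by rewrite -powRrM mulVf ?powRr1// gt_eqF.
by apply: ge0_ler_powR; rewrite ?nnegrE ?powR_ge0 ?divr_ge0// ltW.
Qed.

(** The layers of [weak_bound_weak_norm] form a geometric series; its ratio [2^(1 - p)] is below 1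
    because p > 1. *)
Lemma dyadic_powR_term (s K m : R) k : 0 < s -> 0 <= K -> (K / s) `^ p = m ->
  s * 2 ^+ k.+1 * (K / (s * 2 ^+ k)) `^ p = 2 * s * m * (2 `^ (1 - p)) ^+ k.
Proof.
move=> s0 K0 Ks; set t : R := 2 ^+ k; have t0 : 0 < t by rewrite exprn_gt0.
rewrite invfM mulrA powRM ?divr_ge0 ?invr_ge0 ?(ltW s0) ?(ltW t0)// Ks.
have -> : t^-1 `^ p = t `^ (- p).
  by rewrite -powR_inv1 ?(ltW t0)// -powRrM mulN1r.
have -> : (2 `^ (1 - p)) ^+ k = t * t `^ (- p).
  rewrite -powR_mulrn ?powR_ge0// -powRrM mulrC powRrM powR_mulrn//.
  by rewrite powRD ?powRr1 ?(ltW t0)// (gt_eqF t0) implybT.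
by rewrite exprS -/t; ring.
Qed.

End RealEstimates.

Section WeakBound.
Context d (T : measurableType d) (R : realType).
Variables (mu : {measure set T -> \bar R}) (p : R).
Hypothesis p1 : 1 < p.
Local Notation q := (p / (p - 1)).

(** The Marcinkiewicz quasinorm of [f] is at most [K]. Operators are estimated in this form because
    level sets are easier to transport than integrals; it agrees with the weak norm up to the factor
    [weak_const]. *)
Definition weak_bound (f : T -> R) (K : R) :=
  forall s : R, 0 < s -> (mu [set x | (s < `|f x|)%R] <= ((K / s) `^ p)%:E)%E.

Lemma measurable_gt_norm (f : T -> R) (s : R) : measurable_fun setT f ->
  measurable [set x | s < `|f x|].
Proof.
move=> mf; have mnf : measurable_fun setT (fun x => `|f x|).
  exact: measurableT_comp.
have := mnf measurableT `]s, +oo[%classic (measurable_itv _).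
by rewrite setTI; congr measurable; apply/seteqP; split => x /=;
  rewrite in_itv/= andbT.
Qed.

Lemma weak_bound_sigma_finite (f : T -> R) K : measurable_fun setT f -> weak_bound f K ->
  sigma_finite [set x | 0 < `|f x|] mu.
Proof.
move=> mf H; exists (fun n => [set x | (n.+1%:R^-1 : R) < `|f x|]).
  apply/seteqP; split => x /=.
    move=> fx0; have [n hn] := ltr_add_invr fx0.
    by exists n => //=; rewrite add0r in hn.
  by move=> [n _ /=]; apply: le_lt_trans; rewrite invr_ge0.
move=> n; split; first exact: measurable_gt_norm.
by apply: le_lt_trans (H _ _) _; rewrite ?invr_gt0 ?ltry.
Qed.

Lemma measurable_norm_EFin (f : T -> R) B : measurable_fun setT f ->
  measurable_fun B (fun x => `|f x|%:E).
Proof.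
move=> mf; apply/measurable_EFinP; apply: measurableT_comp => //.
exact: measurable_funS mf.
Qed.

Lemma weak_norm_integral (f : T -> R) K B : measurable_fun setT f ->
  (weak_norm mu p f <= K%:E)%E -> measurable B -> (mu B < +oo)%E ->
  (\int[mu]_(x in B) `|f x|%:E <= (K * (fine (mu B)) `^ q^-1)%:E)%E.
Proof.
move=> mf fK mB Boo.
have K0 : 0 <= K by rewrite -lee_fin (le_trans _ fK)// weak_norm_ge0.
have [B0|B0] := eqVneq (mu B) 0%E.
  have mEf : measurable_fun B (EFin \o f).
    by apply/measurable_EFinP; exact: measurable_funS mf.
  rewrite [leLHS](integral_abs_eq0 mB mEf B0).
  by rewrite lee_fin mulr_ge0// powR_ge0.
have B0oo : (0 < mu B < +oo)%E by rewrite lt0e B0 Boo/= andbT.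
have := le_trans (weak_norm_ub p f mB B0oo) fK.
have Bfin : mu B \is a fin_num by rewrite ge0_fin_numE.
have fB0 : 0 < fine (mu B) by rewrite fine_gt0.
rewrite -{1}(fineK Bfin) poweR_EFin inver gt_eqF ?powR_gt0//.
by rewrite lee_pdivrMr ?powR_gt0// EFinM.
Qed.

(** Chebyshev's inequality on the level set. Its measure is not known to be finite beforehand, so
    the set is first exhausted by subsets of finite measure. *)
Lemma weak_norm_weak_bound (f : T -> R) K : measurable_fun setT f ->
  sigma_finite [set x | 0 < `|f x|] mu ->
  (weak_norm mu p f <= K%:E)%E -> weak_bound f K.
Proof.
move=> mf [F fF HF] fK s s0.
have K0 : 0 <= K by rewrite -lee_fin (le_trans _ fK)// weak_norm_ge0.
pose D := [set x | s < `|f x|].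
have mD : measurable D by exact: measurable_gt_norm.
pose G n := D `&` \big[setU/set0]_(i < n) F i.
have mG n : measurable (G n).
  by apply: measurableI => //; apply: bigsetU_measurable => i _; case: (HF i).
have UG : \bigcup_n G n = D.
  rewrite -setI_bigcupr; apply/setIidPl => x Dx.
  have : (\bigcup_n F n) x by rewrite -fF /=; exact: lt_trans Dx.
  by move=> [n _ Fx]; exists n.+1 => //; rewrite big_ord_recr; right.
have -> : [set x | s < `|f x|] = \bigcup_n G n by rewrite UG.
have ndG : {homo G : n m / (n <= m)%N >-> (n <= m)%O}.
  move=> n m nm; apply/subsetPset => x [Dx].
  rewrite -bigcup_mkord => -[i /= im Fx]; split=> //.
  by rewrite -bigcup_mkord; exists i => //=; exact: leq_trans nm.
have Goo n : (mu (G n) < +oo)%E.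
  apply: (@le_lt_trans _ _ (mu (\big[setU/set0]_(i < n) F i))).
    apply: le_measure; rewrite ?inE//.
      by apply: bigsetU_measurable => i _; case: (HF i).
    by move=> x [].
  apply: (@le_lt_trans _ _ (\sum_(i < n) mu (F i))%E).
    by apply: Boole_inequality => i; case: (HF i).
  by apply: lte_sum_pinfty => i _; case: (HF i).
have mUG : measurable (\bigcup_n G n) by rewrite UG.
apply: cvge_to_le (nondecreasing_cvg_mu mG mUG ndG) _.
apply: nearW => n /=.
have Gfin : mu (G n) \is a fin_num by rewrite ge0_fin_numE.
rewrite -(fineK Gfin) lee_fin; apply: weak_bound_of_strong => //.
rewrite -lee_fin EFinM fineK//.
apply: le_trans (weak_norm_integral mf fK (mG n) (Goo n)).
rewrite -integral_cst//; apply: ge0_le_integral => //.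
- by move=> x _; rewrite lee_fin ltW.
- exact: measurable_norm_EFin.
- by move=> x [Dx _]; rewrite lee_fin ltW.
Qed.

Let z : R := 2 `^ (1 - p).

Let z01 : 0 < z < 1.
Proof.
rewrite /z powR_gt0//= -opprB powRN invf_lt1 ?powR_gt0//.
apply: (@le_lt_trans _ _ (1 `^ (p - 1))); first by rewrite powR1.
apply: gt0_ltr_powR.
- by rewrite subr_gt0.
- by rewrite nnegrE.
- by rewrite nnegrE.
- by rewrite ltr1n.
Qed.

(** The values of [|f|] up to the cutting height contribute 1, and the dyadic layers above it sum to
    the second term. *)
Definition weak_const : R := 1 + 2 * (1 - z)^-1.

Lemma weak_const_gt0 : 0 < weak_const.
Proof.
case/andP: z01 => _ z1.
by rewrite ltr_wpDr// mulr_ge0// invr_ge0 subr_ge0 ltW.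
Qed.

(* Cut at the heights [s 2^k], where [s = K mu(B)^(-1/p)]. *)
Lemma weak_bound_weak_norm (f : T -> R) K : measurable_fun setT f -> 0 < K ->
  weak_bound f K -> (weak_norm mu p f <= (weak_const * K)%:E)%E.
Proof.
move=> mf K0 H; apply: weak_norm_le.
  by rewrite lee_fin mulr_ge0 ?ltW ?weak_const_gt0.
move=> B mB B0oo; have /andP[B0 Boo] := B0oo.
have Bfin : mu B \is a fin_num by rewrite ge0_fin_numE.
set m := fine (mu B); have m0 : 0 < m by rewrite fine_gt0.
rewrite -(fineK Bfin) -/m poweR_EFin inver gt_eqF ?powR_gt0//.
rewrite lee_pdivrMr ?powR_gt0// -EFinM.
have p0 : 0 < p by rewrite (lt_trans _ p1).
pose s := K / m `^ p^-1; have s0 : 0 < s by rewrite divr_gt0// powR_gt0.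
have sm : s * m = K * m `^ q^-1.
  rewrite /s [X in _ * X](powR_conj p1 (ltW m0)) mulrA divfK//.
  by rewrite gt_eqF ?powR_gt0.
have Ks : (K / s) `^ p = m.
  rewrite /s invf_div mulrCA divff ?gt_eqF// mulr1.
  by rewrite -powRrM mulVf ?powRr1 ?gt_eqF// ltW.
pose D k := [set x | s * 2 ^+ k < `|f x|].
have mD k : measurable (D k) by exact: measurable_gt_norm.
pose h k x : \bar R := ((s * 2 ^+ k.+1) * \1_(D k) x)%:E.
have c0 k : 0 <= s * 2 ^+ k by rewrite mulr_ge0 ?exprn_ge0// ltW.
have h0 k x : (0 <= h k x)%E by rewrite /h lee_fin mulr_ge0.
have mh k : measurable_fun B (h k).
  apply/measurable_EFinP; apply: measurable_funM => //.
have fh x : (`|f x|%:E <= s%:E + \sum_(0 <= k <oo) h k x)%E.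
  have [fxs|sfx] := leP `|f x| s.
    by rewrite -[leLHS]adde0; apply: leeD; rewrite ?lee_fin// nneseries_ge0.
  have exn : exists n, `|f x| <= s * 2 ^+ n.
    exists (Num.bound (`|f x| / s)); rewrite mulrC -ler_pdivrMr//.
    apply: ltW; apply: lt_le_trans (archi_boundP _) _.
      by rewrite divr_ge0// ltW.
    by rewrite -natrX ler_nat ltnW// ltn_expl.
  (* By minimality [|f x|] lies between [s * 2^k] and [s * 2^(k+1)], so the single layer [h k]
     already dominates it. *)
  case: (ex_minnP exn) => -[|k] hk hmin.
    by move: hk; rewrite expr0 mulr1 leNgt sfx.
  have Dk : D k x.
    by rewrite /D/= ltNge; apply/negP => /hmin; rewrite ltnn.
  apply: (@le_trans _ _ (h k x)).
    by rewrite /h indicE mem_set// mulr1 lee_fin.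
  rewrite -[leLHS]add0e; apply: leeD; first by rewrite lee_fin ltW.
  apply: le_trans (nneseries_lim_ge k.+1 _) => //.
  by rewrite big_mkord big_ord_recr/= leeDr// sume_ge0.
apply: (@le_trans _ _ (\int[mu]_(x in B) (s%:E + \sum_(0 <= k <oo) h k x))%E).
  apply: ge0_le_integral => //; first exact: measurable_norm_EFin.
  apply: emeasurable_funD => //; apply: ge0_emeasurable_sum => //.
rewrite ge0_integralD//; last 3 first.
- by move=> x _; rewrite lee_fin ltW.
- by move=> x _; exact: nneseries_ge0.
- exact: ge0_emeasurable_sum.
rewrite integral_cst// integral_nneseries// -(fineK Bfin) -/m -EFinM sm.
rewrite /weak_const -mulrA mulrDl mul1r EFinD; apply: leeD => //.
apply: lime_le; first by apply: is_cvg_nneseries => n _ _; exact: integral_ge0.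
apply: nearW => n; rewrite big_mkord.
apply: (@le_trans _ _ (\sum_(k < n) (2 * s * m * z ^+ k)%:E)%E).
  apply: lee_sum => k _.
  rewrite /h; under eq_integral do rewrite EFinM.
  rewrite ge0_integralZl_EFin//; last exact/measurable_EFinP/measurable_indic.
  rewrite integral_indic//.
  apply: (@le_trans _ _ ((s * 2 ^+ k.+1)%:E * ((K / (s * 2 ^+ k)) `^ p)%:E)%E).
    apply: lee_wpmul2l; first by rewrite lee_fin.
    have sk : 0 < s * 2 ^+ k by rewrite mulr_gt0// exprn_gt0.
    apply: le_trans (H _ sk); apply: le_measure; rewrite ?inE//.
      exact: measurableI.
    exact: measurable_gt_norm.
  by rewrite -EFinM lee_fin (dyadic_powR_term _ s0 (ltW K0) Ks).
rewrite sumEFin lee_fin.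
have -> : \sum_(i < n) 2 * s * m * z ^+ i = series (geometric (2 * s * m) z) n.
  by rewrite /series/= big_mkord.
have /andP[z0 z1] := z01.
apply: le_trans (geometric_le_lim _ _ z0 _) _.
- by apply: mulr_ge0; [apply: mulr_ge0|]; rewrite // ltW.
- by rewrite gtr0_norm.
- by rewrite -sm [leLHS](_ : _ = 2 / (1 - z) * (s * m))//; ring.
Qed.

End WeakBound.

Section Classes.
Context d (T : measurableType d) (R : realType).
Variables (mu : {measure set T -> \bar R}) (p : R).
Hypothesis p1 : 1 < p.

Lemma weakLp_fun_measurable (f : weakLp_fun mu p) : measurable_fun setT f.
Proof. exact: measurable_funPT. Qed.

Lemma weakLp_fun_weak_bound (f : weakLp_fun mu p) K :
  (weak_norm mu p f <= K%:E)%E -> weak_bound mu p f K.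
Proof.
have /asboolP[sf _] := valP f.
exact: (weak_norm_weak_bound p1 (weakLp_fun_measurable f) sf).
Qed.

Lemma weakLp_fun_sigma_finite (f : weakLp_fun mu p) :
  sigma_finite [set x | 0 < `|f x|] mu.
Proof. by have /asboolP[] := valP f. Qed.

Lemma weakLp_fun_norm (f : weakLp_fun mu p) :
  exists2 K, 0 <= K & (weak_norm mu p f <= K%:E)%E.
Proof.
have /fineK fE := weak_norm_fin_num f.
exists (fine (weak_norm mu p f)); first by rewrite fine_ge0// weak_norm_ge0.
by rewrite fE.
Qed.

Lemma weakLp_fun_exists (f : T -> R) K : measurable_fun setT f -> 0 < K ->
  weak_bound mu p f K ->
  exists h : weakLp_fun mu p, (h : T -> R) = f.
Proof.
move=> mf K0 fK.
pose F := isMeasurableFun.Build _ _ _ _ f mf.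
pose g : {mfun T >-> R} := HB.pack f F.
have gL : g \in weakLp_pred mu p.
  apply/asboolP; split; first exact: weak_bound_sigma_finite mf fK.
  exact: le_lt_trans (weak_bound_weak_norm p1 mf K0 fK) (ltry _).
by exists (WeakLpFun gL).
Qed.

Lemma weak_norm0_ae (f : weakLp_fun mu p) :
  (forall K, 0 < K -> (weak_norm mu p f <= K%:E)%E) -> f = cst 0 %[ae mu].
Proof.
move=> f0; apply: (@weak_norm_eq0 _ _ _ mu p).
  exact: weakLp_fun_sigma_finite.
apply/eqP; rewrite eq_le weak_norm_ge0 andbT.
by apply/lee_addgt0Pr => e e0; rewrite add0e f0.
Qed.

End Classes.

(** * Bounded operators between spaces of classes, in particular compositions *)

Section OperatorOnClasses.
Context d (T : measurableType d) d' (T' : measurableType d') (R : realType).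
Variables (mu : {measure set T -> \bar R}) (mu' : {measure set T' -> \bar R}).
Variable p : R.
Hypothesis p1 : 1 < p.

(* A linear operator on the spaces of classes is given by an operator on
   functions that is linear up to null sets; compatibility with a.e. equality
   is then a consequence of the weak type bound. *)
Lemma weakLp_operator (F : weakLp_fun mu p -> T' -> R) (C : R) : 0 < C ->
  (forall f, measurable_fun setT (F f)) ->
  (forall (f : weakLp_fun mu p) K, 0 < K ->
    (weak_norm mu p f <= K%:E)%E -> weak_bound mu' p (F f) (C * K)) ->
  (forall a f g, F (a *: f + g) = (fun y => a * F f y + F g y) %[ae mu']) ->
  exists2 Phi : {linear weakLp mu p -> weakLp mu' p}, continuous Phi &
    forall f : weakLp_fun mu p,
      exists2 h : weakLp_fun mu' p, (h : T' -> R) = F f &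
        Phi (\pi_(weakLp mu p) f)%qT = (\pi_(weakLp mu' p) h)%qT.
Proof.
move=> C0 mF bF lF.
have exG f : exists h : weakLp_fun mu' p, (h : T' -> R) = F f.
  have [K K0 fK] := weakLp_fun_norm f.
  have K1 : 0 < K + 1 by rewrite ltr_wpDl.
  apply: (@weakLp_fun_exists _ _ _ mu' p p1 _ (C * (K + 1))) => //.
    by rewrite mulr_gt0.
  by apply: bF => //; apply: le_trans fK _; rewrite lee_fin lerDl.
have [G GE] := choice exG.
have GN (f : weakLp_fun mu p) K : 0 < K -> (weak_norm mu p f <= K%:E)%E ->
    (weak_norm mu' p (G f) <= (weak_const p * (C * K))%:E)%E.
  move=> K0 fK; apply: weak_bound_weak_norm => //.
  - by rewrite mulr_gt0.
  - by rewrite GE; exact: bF.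
have wC0 : 0 < weak_const p * C by rewrite mulr_gt0// weak_const_gt0.
have Gae (f g : weakLp_fun mu p) : (f : T -> R) = g %[ae mu] -> (G f : T' -> R) = G g %[ae mu'].
  move=> fg; have h0 : (G (f - g) : T' -> R) = cst 0 %[ae mu'].
    apply: (weak_norm0_ae (p := p)) => K K0.
    rewrite -[K](mulVKf (lt0r_neq0 wC0)) -mulrA; apply: GN.
      by rewrite mulr_gt0// invr_gt0.
    rewrite (_ : weak_norm _ _ _ = 0%E) ?lee_fin ?mulr_ge0 ?invr_ge0 ?ltW//.
    rewrite (@weak_norm_ae_eq _ _ _ mu p _ (cst 0 : {mfun T >-> R})).
      have := weak_normZ mu p 0 f; rewrite normr0 mul0e => <-.
      by congr weak_norm; apply/funext => x; rewrite mul0r.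
    apply: filterS fg => x /(_ Logic.I) fx _.
    by rewrite weakLp_funD weakLp_funN fx subrr.
  have := lF 1 (f - g) g; rewrite scale1r subrK -!GE => e1.
  apply: filterS2 h0 e1 => x /(_ Logic.I) e0 /(_ Logic.I) e1 _.
  by rewrite e1 mul1r e0 add0r.
pose P (u : weakLp mu p) : weakLp mu' p := (\pi_(weakLp mu' p) (G (repr u)))%qT.
have PE f : P (\pi_(weakLp mu p) f)%qT = (\pi_(weakLp mu' p) (G f))%qT.
  by apply/weakLp_eqP/Gae; exact: weakLp_reprK.
have lP : linear P.
  move=> a u v; rewrite -[u]reprK -[v]reprK -weakLp_piZ -weakLp_piD !PE.
  rewrite -weakLp_piZ -weakLp_piD; apply/weakLp_eqP.
  apply: filterS (lF a (repr u) (repr v)) => x /(_ Logic.I) e _.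
  by rewrite GE e weakLp_funD weakLp_funZ !GE.
pose PL := GRing.isLinear.Build _ _ _ _ P lP.
pose Phi : {linear weakLp mu p -> weakLp mu' p} := HB.pack P PL.
exists Phi; last first.
  by move=> f; exists (G f); rewrite ?GE// /Phi /= PE.
apply: bounded_linear_continuous; apply/linear_boundedP.
exists (weak_const p * C); split; first exact: gtr0_real.
move=> r Cr u; apply: (@le_trans _ _ (weak_const p * C * `|u|)); last first.
  by rewrite ler_wpM2r// ltW.
(* [GN] takes positive bounds only and [u] may vanish, hence the margin [e]. *)
apply/ler_addgt0Pr => e e0.
rewrite -lee_fin -[u]reprK /Phi /= PE weakLp_normE.
apply: le_trans (GN _ (`|u| + e / (weak_const p * C)) _ _) _.
- by rewrite ltr_wpDl// divr_gt0.
- by rewrite -weakLp_normE reprK lee_fin lerDl divr_ge0// ltW.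
- by rewrite lee_fin mulrA mulrDr mulrCA divff ?mulr1 ?gt_eqF// reprK.
Qed.

End OperatorOnClasses.

Section Composition.
Context d (T : measurableType d) d' (T' : measurableType d') (R : realType).
Variables (mu : {measure set T -> \bar R}) (mu' : {measure set T' -> \bar R}).
Variables (p c : R) (psi : T' -> T) (E : set T').
Hypothesis p1 : 1 < p.
Hypothesis c0 : 0 < c.
Hypothesis mpsi : measurable_fun setT psi.
Hypothesis mE : measurable E.
Hypothesis psiB : forall B, measurable B ->
  (mu' (E `&` psi @^-1` B) <= c%:E * mu B)%E.

(** The level sets of the image are the parts in [E] of the preimages under [psi], so their measure
    grows at most by [c]; by homogeneity this is the operator constant [c^(1/p)]. *)
Lemma composition_operator :
  exists2 Phi : {linear weakLp mu p -> weakLp mu' p}, continuous Phi &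
    forall f : weakLp_fun mu p,
      exists2 h : weakLp_fun mu' p, (h : T' -> R) =
        (fun y => \1_E y * f (psi y)) &
        Phi (\pi_(weakLp mu p) f)%qT = (\pi_(weakLp mu' p) h)%qT.
Proof.
have p0 : 0 < p by rewrite (lt_trans _ p1).
apply: (weakLp_operator p1 (F := fun f y => \1_E y * f (psi y))
  (powR_gt0 p^-1 c0)).
- move=> f; apply: measurable_funM => //.
  by apply: measurableT_comp => //; exact: weakLp_fun_measurable.
- move=> f K K0 /(weakLp_fun_weak_bound p1) fK s s0.
  have mfs := measurable_gt_norm s (weakLp_fun_measurable f).
  apply: (@le_trans _ _ (mu' (E `&` psi @^-1` [set x | s < `|f x|]))).
    apply: le_measure; rewrite ?inE//.
    - apply: measurable_gt_norm; apply: measurable_funM => //.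
      by apply: measurableT_comp => //; exact: weakLp_fun_measurable.
    - apply: measurableI => //; rewrite -[X in measurable X]setTI.
      exact: mpsi.
    move=> y /=; rewrite indicE; case: (boolP (y \in E)) => [/set_mem yE|_].
      by rewrite mul1r.
    by rewrite mul0r normr0 ltNge ltW.
  apply: le_trans (psiB mfs) _.
  apply: le_trans (lee_wpmul2l _ (fK s s0)) _; first by rewrite lee_fin ltW.
  rewrite -EFinM lee_fin -mulrA [leRHS]powRM ?powR_ge0 ?divr_ge0 ?(ltW K0) ?(ltW s0)//.
  by rewrite -powRrM mulVf ?gt_eqF// powRr1// ltW.
- move=> a f g; apply: aeW => y _.
  by rewrite weakLp_funD weakLp_funZ mulrDr mulrCA.
Qed.

End Composition.

Section MeasurableMaps.
Context {R : realType}.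

(** [A] is composition with [psi] cut to [E], and [B] composition with [phi] cut to [E']. The second
    cancellation is conditional so that the lemma serves for retractions and for isomorphisms. *)
Lemma complemented_of_maps d (T : measurableType d) d' (T' : measurableType d')
    (mu : {measure set T -> \bar R}) (mu' : {measure set T' -> \bar R})
    (p c : R) (psi : T' -> T) (phi : T -> T') (E : set T') (E' : set T) :
  1 < p -> 0 < c ->
  measurable_fun setT psi -> measurable_fun setT phi ->
  measurable E -> measurable E' ->
  (forall B, measurable B -> (mu' (E `&` psi @^-1` B) <= c%:E * mu B)%E) ->
  (forall B, measurable B -> (mu (E' `&` phi @^-1` B) <= c%:E * mu' B)%E) ->
  {ae mu, forall x, [/\ E' x, E (phi x) & psi (phi x) = x]} ->
  exists (A : {linear weakLp mu p -> weakLp mu' p})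
    (B : {linear weakLp mu' p -> weakLp mu p}),
    [/\ continuous A, continuous B, cancel A B &
      {ae mu', forall y, [/\ E y, E' (psi y) & phi (psi y) = y]} ->
      cancel B A].
Proof.
move=> p1 c0 mpsi mphi mE mE' psiB phiB H.
have [A cA HA] := composition_operator p1 c0 mpsi mE psiB.
have [B cB HB] := composition_operator p1 c0 mphi mE' phiB.
exists A, B; split => //.
  move=> u; rewrite -[u]reprK; have [h hE ->] := HA (repr u).
  have [g gE ->] := HB h; apply/weakLp_eqP; rewrite gE.
  apply: filterS H => x [E'x Ex e] _.
  by rewrite hE !indicE !mem_set// !mul1r e.
move=> H' u; rewrite -[u]reprK; have [h hE ->] := HB (repr u).
have [g gE ->] := HA h; apply/weakLp_eqP; rewrite gE.
apply: filterS H' => x [E'x Ex e] _.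
by rewrite hE !indicE !mem_set// !mul1r e.
Qed.

Lemma complemented_of_ae_retraction d (T : measurableType d) d'
    (T' : measurableType d')
    (mu : {measure set T -> \bar R}) (mu' : {measure set T' -> \bar R})
    (p c : R) (psi : T' -> T) (phi : T -> T') (E : set T') (E' : set T) :
  1 < p -> 0 < c ->
  measurable_fun setT psi -> measurable_fun setT phi ->
  measurable E -> measurable E' ->
  (forall B, measurable B -> (mu' (E `&` psi @^-1` B) <= c%:E * mu B)%E) ->
  (forall B, measurable B -> (mu (E' `&` phi @^-1` B) <= c%:E * mu' B)%E) ->
  {ae mu, forall x, [/\ E' x, E (phi x) & psi (phi x) = x]} ->
  complemented (weakLp mu p) (weakLp mu' p).
Proof.
move=> p1 c0 mpsi mphi mE mE' psiB phiB H.
have [A [B [cA cB AB _]]] :=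
  complemented_of_maps p1 c0 mpsi mphi mE mE' psiB phiB H.
by exists A, B.
Qed.

(** [E] and its complement are both copies of the whole space, through [phi0] and [phi1]; a function
    is identified with its two restrictions, pulled back to the whole space. *)
Lemma square_of_splitting d (T : measurableType d)
    (mu : {measure set T -> \bar R}) (p c : R)
    (phi0 phi1 psi0 psi1 : T -> T) (E : set T) :
  1 < p -> 0 < c -> measurable E ->
  measurable_fun setT phi0 -> measurable_fun setT phi1 ->
  measurable_fun setT psi0 -> measurable_fun setT psi1 ->
  (forall B, measurable B -> (mu (phi0 @^-1` B) <= c%:E * mu B)%E) ->
  (forall B, measurable B -> (mu (phi1 @^-1` B) <= c%:E * mu B)%E) ->
  (forall B, measurable B -> (mu (E `&` psi0 @^-1` B) <= c%:E * mu B)%E) ->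
  (forall B, measurable B -> (mu (~` E `&` psi1 @^-1` B) <= c%:E * mu B)%E) ->
  {ae mu, forall x, E (phi0 x) /\ psi0 (phi0 x) = x} ->
  {ae mu, forall x, ~ E (phi1 x) /\ psi1 (phi1 x) = x} ->
  {ae mu, forall x, (E x -> phi0 (psi0 x) = x) /\
                    (~ E x -> phi1 (psi1 x) = x)} ->
  linearly_homeomorphic (weakLp mu p) (weakLp mu p * weakLp mu p)%type.
Proof.
move=> p1 c0 mE mf0 mf1 mp0 mp1 f0B f1B p0B p1B H0 H1 H.
have mEC : measurable (~` E) by exact: measurableC.
have tB phi : (forall B, measurable B -> (mu (phi @^-1` B) <= c%:E * mu B)%E) ->
    forall B, measurable B -> (mu (setT `&` phi @^-1` B) <= c%:E * mu B)%E.
  by move=> h B mB; rewrite setTI h.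
have [A0 cA0 HA0] := composition_operator p1 c0 mf0 measurableT (tB _ f0B).
have [A1 cA1 HA1] := composition_operator p1 c0 mf1 measurableT (tB _ f1B).
have [B0 cB0 HB0] := composition_operator p1 c0 mp0 mE p0B.
have [B1 cB1 HB1] := composition_operator p1 c0 mp1 mEC p1B.
apply: (square_of_linear cA0 cA1 cB0 cB1).
- move=> u; rewrite -[u]reprK.
  have [h0 h0E ->] := HA0 (repr u); have [h1 h1E ->] := HA1 (repr u).
  have [g0 g0E ->] := HB0 h0; have [g1 g1E ->] := HB1 h1.
  rewrite -weakLp_piD; apply/weakLp_eqP.
  apply: filterS H => x [e0 e1] _; rewrite weakLp_funD g0E g1E h0E h1E.
  rewrite !indicE !in_setT !mul1r in_setC.
  case: (boolP (x \in E)) => [/set_mem /e0 ->|/negP xE].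
    by rewrite mul1r mul0r addr0.
  by rewrite mul0r mul1r add0r e1// => /mem_set.
- move=> u v; rewrite -[u]reprK -[v]reprK.
  have [h0 h0E ->] := HB0 (repr u); have [h1 h1E ->] := HB1 (repr v).
  rewrite -weakLp_piD; have [g0 g0E ->] := HA0 (h0 + h1); apply/weakLp_eqP.
  apply: filterS H0 => x [e0 e1] _; rewrite g0E weakLp_funD h0E h1E.
  rewrite !indicE in_setT in_setC (mem_set e0) e1.
  by rewrite !mul1r mul0r addr0.
- move=> u v; rewrite -[u]reprK -[v]reprK.
  have [h0 h0E ->] := HB0 (repr u); have [h1 h1E ->] := HB1 (repr v).
  rewrite -weakLp_piD; have [g1 g1E ->] := HA1 (h0 + h1); apply/weakLp_eqP.
  apply: filterS H1 => x [e0 e1] _; rewrite g1E weakLp_funD h0E h1E.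
  rewrite !indicE in_setT in_setC e1 (memNset e0).
  by rewrite !mul1r mul0r add0r.
Qed.

End MeasurableMaps.

(** * Radon-Nikodym for set functions of weak type *)

Section FiniteSums.
Context {R : realType} (p : R).
Hypothesis p1 : 1 < p.
Local Notation q := (p / (p - 1)).

(* Split the sum at the height [t] for which both parts have the same bound. *)
Lemma sum_weighted_le (I : finType) (w G : I -> R) (M : R) : 0 <= M ->
  (forall i, 0 <= w i <= 1) -> (forall i, 0 <= G i) ->
  (forall D : {set I}, \sum_(i in D) G i <= M * #|D|%:R `^ q^-1) ->
  \sum_i w i * G i <= 2 * M * (\sum_i w i) `^ q^-1.
Proof.
move=> M0 w01 G0 GD; set tau := \sum_i w i.
have p0 : 0 < p by rewrite (lt_trans _ p1).
have w0 i : 0 <= w i by case/andP: (w01 i).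
have tau_ge0 : 0 <= tau by exact: sumr_ge0.
have [tau0|tauN0] := eqVneq tau 0.
  have wi0 i : w i = 0.
    exact: (psumr_eq0P (fun i _ => w0 i) tau0).
  rewrite big1 => [|i _]; last by rewrite wi0 mul0r.
  by rewrite mulr_ge0 ?powR_ge0 ?mulr_ge0.
have tau_gt0 : 0 < tau by rewrite lt_neqAle eq_sym tauN0.
have [M00|MN0] := eqVneq M 0.
  have Gi0 i : G i = 0.
    have := GD [set i]%SET; rewrite M00 mul0r big_set1 => Gi.
    by apply/eqP; rewrite eq_le Gi G0.
  rewrite big1 => [|i _]; last by rewrite Gi0 mulr0.
  by rewrite mulr_ge0 ?powR_ge0 ?mulr_ge0.
have M_gt0 : 0 < M by rewrite lt_neqAle eq_sym MN0.
pose t := M / tau `^ p^-1; have t0 : 0 < t by rewrite divr_gt0// powR_gt0.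
pose D := [set i | t < G i]%SET.
have Dtau : #|D|%:R <= tau.
  have -> : tau = (M / t) `^ p.
    rewrite /t invf_div mulrCA divff ?gt_eqF// mulr1 -powRrM mulVf ?gt_eqF//.
    by rewrite powRr1.
  apply: weak_bound_of_strong => //; apply: le_trans (GD D).
  rewrite -sum1_card natr_sum mulr_sumr; apply: ler_sum => i.
  by rewrite inE mulr1 => /ltW.
have ttau : t * tau = M * tau `^ q^-1.
  rewrite /t [X in _ * X](powR_conj p1 tau_ge0) mulrA divfK//.
  by rewrite gt_eqF ?powR_gt0.
rewrite -mulrA mulrDl mul1r -{1}ttau /tau mulr_sumr.
apply: (@le_trans _ _ (\sum_i (t * w i + (if i \in D then G i else 0)))).
  apply: ler_sum => i _; case: ifPn => [_|].
    apply: ler_wpDl; first by rewrite mulr_ge0// ltW.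
    by apply: ler_piMl => //; case/andP: (w01 i).
  by rewrite inE -leNgt addr0 mulrC => Gt; rewrite ler_wpM2r.
rewrite big_split/= lerD2l -big_mkcond; apply: le_trans (GD D) _.
rewrite ler_wpM2l// ge0_ler_powR// ?nnegrE//.
exact: ltW (conj_inv_gt0 p1).
Qed.

End FiniteSums.

Section Integrals.
Context d (T : measurableType d) (R : realType).
Variables (mu : {measure set T -> \bar R}) (p : R).
Hypothesis p1 : 1 < p.
Local Notation q := (p / (p - 1)).

Lemma weak_norm_integrable (f : T -> R) K B : measurable_fun setT f ->
  (weak_norm mu p f <= K%:E)%E -> measurable B -> (mu B < +oo)%E ->
  mu.-integrable B (EFin \o f).
Proof.
move=> mf fK mB Boo; apply/integrableP; split.
  by apply/measurable_EFinP; exact: measurable_funS mf.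
exact: le_lt_trans (weak_norm_integral mf fK mB Boo) (ltry _).
Qed.

(** The sum is at most the integral of [|f|] over the union of the sets, to which the weak norm
    applies. *)
Lemma sum_norm_Rintegral_le (I : finType) (P : {set I}) (B : I -> set T)
    (f : T -> R) K m : measurable_fun setT f ->
  (weak_norm mu p f <= K%:E)%E ->
  (forall i, measurable (B i)) -> trivIset [set` P] B ->
  (forall i, i \in P -> mu (B i) = m%:E) ->
  \sum_(i in P) `|\int[mu]_(x in B i) f x| <= K * (#|P|%:R * m) `^ q^-1.
Proof.
move=> mf fK mB tB Bm.
have PE : [set` enum P] = [set` P].
  by apply/seteqP; split => i /=; rewrite mem_enum.
pose U := \big[setU/set0]_(i <- enum P) B i.
have mU : measurable U by exact: bigsetU_measurable.
have muU : mu U = (#|P|%:R * m)%:E.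
  have -> : mu U = (\int[mu]_(x in U) cst 1 x)%E by rewrite integral_cst// mul1e.
  rewrite ge0_integral_bigsetU ?enum_uniq ?PE// big_enum/=.
  under eq_bigr => i Pi do rewrite integral_cst// mul1e Bm//.
  by rewrite sumEFin sumr_const mulr_natl.
have Uoo : (mu U < +oo)%E by rewrite muU ltry.
have := weak_norm_integral mf fK mU Uoo; rewrite muU/=.
rewrite ge0_integral_bigsetU ?enum_uniq ?PE//; last exact: measurable_norm_EFin.
rewrite -lee_fin; apply: le_trans; rewrite big_enum/= -sumEFin.
apply: lee_sum => i Pi.
have Bi : (mu (B i) < +oo)%E by rewrite Bm// ltry.
rewrite EFin_normr_Rintegral//; last exact: weak_norm_integrable fK _ _.
apply: le_abse_integral => //.
by apply/measurable_EFinP; exact: measurable_funS mf.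
Qed.

End Integrals.

Section GeneralizedLimit.
Context {R : realType}.

(** The limit along an ultrafilter finer than [\oo], which exists for bounded sequences by
    compactness of [[- M, M]]. For other sequences the value is arbitrary, hence the bounds in the
    clauses. *)
Lemma generalized_limit : exists L : (nat -> R) -> R,
  [/\ forall a u v (M : R), (forall j, `|u j| <= M) -> (forall j, `|v j| <= M) ->
        L (fun j => a * u j + v j) = a * L u + L v,
      forall u (M : R), (forall j, `|u j| <= M) -> `|L u| <= M &
      forall u c, (\forall j \near \oo, u j = c) -> L u = c].
Proof.
have [U [UU ooU]] := ultraFilterLemma (eventually_filter : ProperFilter \oo).
have cvgU (u : nat -> R) (M : R) : (forall j, `|u j| <= M) -> cvg (u @ U).
  move=> uM; have /(_ (u @ U)) := @segment_compact R (- M) M.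
  have UuM : U (u @^-1` `[- M, M]%classic).
    by apply: filterE => j /=; rewrite in_itv/=; move: (uM j); rewrite ler_norml.
  move=> /(_ _ UuM)[c [_ cc]]; apply/cvg_ex; exists c => A cA.
  have [//|UA] := in_ultra_setVsetC (u @^-1` A) UU.
  have /(_ (~` A) A UA cA) [x [/= nAx Ax]] := cc.
  by [].
exists (fun u => lim (u @ U)); split.
- move=> a u v M uM vM; apply: cvg_lim => //.
  apply: cvgD; last exact: cvgU vM.
  by apply: cvgM; [exact: cvg_cst|exact: cvgU uM].
- move=> u M uM; have /cvg_norm/cvg_lim <- // := cvgU u M uM.
  apply: limr_le; last exact: nearW.
  by apply: is_cvg_norm; exact: cvgU uM.
- move=> u c uc; apply: cvg_lim => //; apply: cvg_near_cst.
  exact: ooU.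
Qed.

End GeneralizedLimit.

Section Density.
Context d (T : measurableType d) (R : realType).
Variables (mu : {measure set T -> \bar R}) (p : R).
Hypothesis p1 : 1 < p.
Local Notation q := (p / (p - 1)).
Variables (D : nat -> set T).
Hypothesis mD : forall k, measurable (D k).
Hypothesis Doo : forall k, (mu (D k) < +oo)%E.
Hypothesis tD : trivIset setT D.
Hypothesis covD : \bigcup_k D k = setT.

Lemma measurable_gt (f : T -> R) (s : R) : measurable_fun setT f ->
  measurable [set x | s < f x].
Proof.
move=> mf; have := mf measurableT `]s, +oo[%classic (measurable_itv _).
by rewrite setTI; congr measurable; apply/seteqP; split => x /=;
  rewrite in_itv/= andbT.
Qed.

(** Confined to single pieces [D k]: [f] need not be integrable on [T], and [nu] need not be
    additive over infinitely many pieces. *)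
Definition local_density (nu : set T -> R) (f : T -> R) :=
  forall k A, measurable A -> A `<=` D k ->
    mu.-integrable A (EFin \o f) /\ \int[mu]_(x in A) f x = nu A.

Definition finite_measure_set (A : set T) := measurable A /\ (mu A < +oo)%E.

(* Finite additivity is enough: countable additivity on each [D k] follows from
   the bound, since [q^-1 > 0]. *)
Definition weak_charge (nu : set T -> R) (C : R) :=
  (forall A B, finite_measure_set A -> finite_measure_set B ->
    A `&` B = set0 -> nu (A `|` B) = nu A + nu B) /\
  (forall A, finite_measure_set A -> `|nu A| <= C * fine (mu A) `^ q^-1).

Lemma finite_measure_setS A B : measurable A -> A `<=` B ->
  finite_measure_set B -> finite_measure_set A.
Proof.
move=> mA AB [mB Boo]; split => //; apply: le_lt_trans Boo.
by apply: le_measure; rewrite ?inE.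
Qed.

Lemma finite_measure_bigsetU (A : nat -> set T) n :
  (forall i, finite_measure_set (A i)) ->
  finite_measure_set (\big[setU/set0]_(i < n) A i).
Proof.
move=> fA; have mA i : measurable (A i) by case: (fA i).
split; first exact: bigsetU_measurable.
apply: (@le_lt_trans _ _ (\sum_(i < n) mu (A i))%E).
  exact: Boole_inequality.
by apply: lte_sum_pinfty => i _; case: (fA i).
Qed.

Section WeakCharge.
Variables (nu : set T -> R) (C : R).
Hypothesis nuC : weak_charge nu C.

Lemma weak_charge0 : nu set0 = 0.
Proof.
have [_ nuB] := nuC; have := nuB set0.
rewrite measure0 powR0 ?mulr0 ?normr_le0 => [nu0|].
  by apply/eqP/nu0; split; rewrite ?measure0.
by rewrite gt_eqF// conj_inv_gt0.
Qed.

Lemma weak_charge_bigsetU (A : nat -> set T) n :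
  (forall i, finite_measure_set (A i)) -> trivIset setT A ->
  nu (\big[setU/set0]_(i < n) A i) = \sum_(i < n) nu (A i).
Proof.
move=> fA tA; elim: n => [|n ih]; first by rewrite !big_ord0 weak_charge0.
rewrite !big_ord_recr/= (nuC.1 _ _ (finite_measure_bigsetU n fA))// ?ih//.
apply/seteqP; split => // x [+ Anx]; rewrite -bigcup_mkord => -[i /= ni Aix].
have /esym := tA i n Logic.I Logic.I (ex_intro _ x (conj Aix Anx)).
by move=> e; move: ni; rewrite /= e ltnn.
Qed.

Lemma weak_charge_cvg0 (A : nat -> set T) :
  (forall i, finite_measure_set (A i)) ->
  mu (A n) @[n --> \oo] --> 0%E -> nu (A n) @[n --> \oo] --> 0.
Proof.
move=> fA A0; have [_ nuB] := nuC.
have q0 := conj_inv_gt0 p1.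
(* Nothing is assumed about the sign of [C]; this majorant is positive and can be divided by. *)
have C0 : 0 <= `|C| + 1 by rewrite addr_ge0.
have C1 : 0 < `|C| + 1 by rewrite ltr_wpDl.
apply/cvgrPdist_le => e e0.
set e' := e / (`|C| + 1); have e'0 : 0 < e' by rewrite divr_gt0.
near=> n; rewrite sub0r normrN.
apply: le_trans (nuB _ (fA n)) _.
apply: (@le_trans _ _ ((`|C| + 1) * e')); last first.
  by rewrite mulrCA divff ?mulr1// gt_eqF.
apply: (@le_trans _ _ ((`|C| + 1) * fine (mu (A n)) `^ q^-1)).
  by rewrite ler_wpM2r ?powR_ge0// ler_wpDr// ler_norm.
rewrite ler_wpM2l//.
have -> : e' = (e' `^ q) `^ q^-1.
  by rewrite -powRrM divff ?powRr1 ?(ltW e'0)// -invr_eq0 gt_eqF.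
have An : fine (mu (A n)) <= e' `^ q.
  rewrite -[leLHS]ger0_norm ?fine_ge0//; near: n.
  have /fine_cvgP[_ /cvgr0Pnorm_le] := A0; apply; exact: powR_gt0.
by apply: ge0_ler_powR; rewrite ?nnegrE ?powR_ge0 ?fine_ge0 ?(ltW q0).
Unshelve. all: by end_near. Qed.

Section FiniteDensity.
Variables (B : set T).
Hypothesis fB : finite_measure_set B.

Let mB : measurable B. Proof. by case: fB. Qed.
Let Boo : (mu B < +oo)%E. Proof. by case: fB. Qed.

Let nuB (A : set T) : \bar R := (nu (A `&` B))%:E.

Let nuB0 : nuB set0 = 0%E.
Proof. by rewrite /nuB set0I weak_charge0. Qed.

Let nuB_fin A : measurable A -> nuB A \is a fin_num.
Proof. by []. Qed.

Let fin_setIB A : measurable A -> finite_measure_set (A `&` B).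
Proof.
by move=> mA; apply: finite_measure_setS fB; [exact: measurableI|move=> x []].
Qed.

Let nuB_sigma_additive : semi_sigma_additive nuB.
Proof.
move=> F mF tF mUF.
(* The tails decrease to the empty set inside [B], so [nu (A n)] tends to 0; by finite additivity it
   is the difference between [nu] of the union cut by [B] and the partial sum. *)
pose A n := (\bigcup_i F i `\` \big[setU/set0]_(i < n) F i) `&` B.
have mS n : measurable (\big[setU/set0]_(i < n) F i) by exact: bigsetU_measurable.
have mA n : measurable (\bigcup_i F i `\` \big[setU/set0]_(i < n) F i).
  exact: measurableD.
have A0 : mu (A n) @[n --> \oo] --> 0%E.
  rewrite -(measure0 mu) (_ : set0 = \bigcap_n A n); last first.
    apply/seteqP; split => // x Ax; have [[[i _ Fix] _] _] := Ax 0%N Logic.I.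
    have [[_ nF] _] := Ax i.+1 Logic.I; apply: nF.
    by rewrite big_ord_recr; right.
  apply: nonincreasing_cvg_mu.
  - by case: (fin_setIB (mA 0%N)).
  - by move=> i; case: (fin_setIB (mA i)).
  - by apply: bigcapT_measurable => i; case: (fin_setIB (mA i)).
  - move=> m n mn; apply/subsetPset => x [[Ux nF] Bx]; split => //; split => //.
    rewrite -bigcup_mkord => -[i /= im Fix]; apply: nF.
    by rewrite -bigcup_mkord; exists i => //=; exact: leq_trans mn.
have nuA := weak_charge_cvg0 (fun n => fin_setIB (mA n)) A0.
have E n : (\sum_(0 <= i < n) nuB (F i))%E =
    (nu (\bigcup_i F i `&` B) - nu (A n))%:E.
  rewrite /nuB sumEFin big_mkord; congr (_%:E); apply/eqP.
  rewrite eq_sym subr_eq; apply/eqP.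
  rewrite -(@weak_charge_bigsetU (fun i => F i `&` B)); last 2 first.
  - by move=> i; exact: fin_setIB.
  - apply/trivIsetP => i j _ _ ij; rewrite setIACA.
    by move/trivIsetP : tF => /(_ i j Logic.I Logic.I ij) ->; rewrite set0I.
  have -> : \big[setU/set0]_(i < n) (F i `&` B) =
      \big[setU/set0]_(i < n) F i `&` B by rewrite big_distrl.
  rewrite -nuC.1; [|exact: fin_setIB|exact: fin_setIB|].
    congr nu; apply/seteqP; split => [x [Ux Bx]|x].
      have [Sx|Sx] := pselect ((\big[setU/set0]_(i < n) F i) x); first by left.
      by right.
    move=> [[+ Bx]|[[Ux _] Bx]//]; rewrite -bigcup_mkord => -[i _ Fix].
    by split => //; exists i.
  by apply/seteqP; split => // x [[? _] [[_ ?] _]].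
rewrite (_ : (fun n => _) = EFin \o (fun n => nu (\bigcup_i F i `&` B) - nu (A n))).
  apply: cvg_EFin; first exact: nearW.
  have := cvgB (cvg_cst (nu (\bigcup_i F i `&` B))) nuA.
  by rewrite subr0; exact.
exact/funext.
Qed.

Let nuB_charge : {charge set T -> \bar R} :=
  HB.pack nuB (isCharge.Build _ _ _ nuB nuB0 nuB_fin nuB_sigma_additive).

Lemma weak_charge_finite_density : exists g : T -> R,
  [/\ measurable_fun setT g, mu.-integrable B (EFin \o g) &
    forall A, measurable A -> A `<=` B ->
      (\int[mu]_(x in A) (g x)%:E)%E = (nu A)%:E].
Proof.
(* Radon-Nikodym is applied to the finite restriction of [mu] to [B]; absolute continuity comes from
   the bound on [nu], and on subsets of [B] integrals against [muB] and [mu] agree. *)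
pose muB : {finite_measure set T -> \bar R} := mfrestr mB Boo.
have dom : nuB_charge `<< muB.
  apply/null_content_dominatesP => A mA.
  rewrite /muB /= /mfrestr /mrestr => A0; rewrite /nuB; congr (_%:E).
  apply/normr0_eq0/eqP; rewrite eq_le normr_ge0 andbT.
  apply: le_trans (nuC.2 _ (fin_setIB mA)) _.
  by rewrite A0 powR0 ?mulr0// gt_eqF// conj_inv_gt0.
pose g := Radon_Nikodym nuB_charge muB.
have gfin x : g x \is a fin_num by exact: Radon_Nikodym_fin_num.
have gint : muB.-integrable setT g by exact: Radon_Nikodym_integrable.
have gE : EFin \o (fine \o g) = g by apply/funext => x /=; rewrite fineK.
exists (fine \o g); split.
- by apply/measurable_EFinP; rewrite gE; exact: measurable_int gint.
- rewrite gE; have /(integrableS measurableT mB) := gint.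
  move=> /(_ (@subsetT _ _))/integrableP[mg goo]; apply/integrableP; split => //.
  rewrite (_ : integral _ _ _ = \int[muB]_(x in B) `|g x|)%E//.
  apply: eq_measure_integral => A mA AB.
  by rewrite /muB /= /mfrestr /mrestr setIidl.
- move=> A mA AB.
  transitivity (\int[muB]_(x in A) g x)%E.
    transitivity (\int[mu]_(x in A) g x)%E.
      by apply: eq_integral => x _ /=; rewrite fineK.
    apply: eq_measure_integral => A' mA' AA'.
    by rewrite /muB /= /mfrestr /mrestr setIidl//; exact: subset_trans AB.
  rewrite -Radon_Nikodym_integral//=.
  by rewrite /nuB setIidl.
Qed.

End FiniteDensity.

(** Chebyshev's inequality with [nu] in place of the integral of [|f|]: it is one-sided because [nu]
    integrates [f] with its sign. It is tested on finitely many pieces at a time, where [nu] is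
    additive and the measure finite. *)
Lemma local_density_upper_bound (f : T -> R) s : 0 <= C -> 0 < s ->
  measurable_fun setT f -> local_density nu f ->
  (mu [set x | (s < f x)%R] <= ((C / s) `^ p)%:E)%E.
Proof.
move=> C0 s0 mf nuf; pose P := [set x | s < f x].
have mP : measurable P by exact: measurable_gt.
pose G n := \big[setU/set0]_(k < n.+1) (P `&` D k).
have fPD k : finite_measure_set (P `&` D k).
  apply: (@finite_measure_setS _ (D k)); last by split.
    exact: measurableI.
  by move=> x [].
have tPD : trivIset setT (fun k => P `&` D k).
  apply/trivIsetP => i j _ _ ij; rewrite setIACA.
  by move/trivIsetP : tD => /(_ i j Logic.I Logic.I ij) ->; rewrite setI0.
have UG : \bigcup_n G n = P.
  by rewrite /G (bigcup_bigsetU_bigcup (fun k => P `&` D k)) -setI_bigcupr covD setIT.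
have mUG : measurable (\bigcup_n G n) by rewrite UG.
rewrite -/P -UG.
have mG n : measurable (G n) by case: (finite_measure_bigsetU n.+1 fPD).
have ndG : {homo G : n m / (n <= m)%N >-> (n <= m)%O}.
  move=> n m nm; apply/subsetPset => x.
  rewrite /G -(bigcup_mkord _ (fun k => P `&` D k)) => -[i /= im Fx].
  rewrite -(bigcup_mkord _ (fun k => P `&` D k)).
  by exists i => //=; exact: leq_trans nm.
apply: cvge_to_le (nondecreasing_cvg_mu mG mUG ndG) _.
apply: nearW => n /=.
have fG := finite_measure_bigsetU n.+1 fPD; have [_ Goo] := fG.
have Gfin : mu (G n) \is a fin_num by rewrite ge0_fin_numE.
rewrite -(fineK Gfin) lee_fin; apply: weak_bound_of_strong => //.
apply: le_trans (nuC.2 _ fG); apply: le_trans (ler_norm _).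
have -> : nu (\big[setU/set0]_(k < n.+1) (P `&` D k)) =
  \sum_(k < n.+1) nu (P `&` D k) := weak_charge_bigsetU n.+1 fPD tPD.
rewrite -lee_fin EFinM fineK//.
have muG : mu (G n) = (\sum_(k < n.+1) mu (P `&` D k))%E.
  apply: (@measure_semi_additive_ord_I _ _ _ mu (fun k => P `&` D k)).
  - by move=> k _; case: (fPD k).
  - exact: sub_trivIset tPD.
  - exact: mG.
rewrite muG ge0_sume_distrr// -sumEFin; apply: lee_sum => k _.
have [mPk Pkoo] := fPD k.
have [fint fE] := nuf k _ mPk (@subIsetr _ _ _).
rewrite -fE /Rintegral fineK; last exact: integrable_fin_num.
rewrite -integral_cst//; apply: ge0_le_integral => //.
- by move=> x _; rewrite lee_fin ltW.
- by apply/measurable_EFinP; exact: measurable_funS mf.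
- by move=> x [/= sfx _]; rewrite lee_fin ltW.
Qed.

End WeakCharge.

Lemma weak_charge_density (nu : set T -> R) C : weak_charge nu C ->
  exists2 f : T -> R, measurable_fun setT f & local_density nu f.
Proof.
move=> nuC.
have fD k : finite_measure_set (D k) by split.
have [g Hg] := choice (fun k => weak_charge_finite_density nuC (fD k)).
have exk x : exists k, D k x.
  have : (\bigcup_k D k) x by rewrite covD.
  by move=> [k _ Dk]; exists k.
have [kx Hkx] := choice exk.
have kxE k x : D k x -> kx x = k.
  by move=> Dk; apply: tD => //; exists x.
pose f x := g (kx x) x.
have fE k x : D k x -> f x = g k x by move=> /kxE; rewrite /f => ->.
have mf : measurable_fun setT f.
  move=> _ Y mY; rewrite setTI.
  have -> : f @^-1` Y = \bigcup_k (D k `&` g k @^-1` Y).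
    apply/seteqP; split => [x /= Yf|x [k _ [Dk /= Yg]]].
      by exists (kx x) => //; split.
    by rewrite /= (fE k).
  apply: bigcup_measurable => k _; have [mg _ _] := Hg k.
  by apply: measurableI => //; rewrite -[X in measurable X]setTI; exact: mg.
exists f => // k A mA AD; have [mg ig gE] := Hg k; split.
  apply: (@eq_integrable _ _ _ _ _ mA (EFin \o g k)).
    by move=> x /set_mem /AD Dk /=; rewrite (fE k).
  exact: integrableS ig.
rewrite /Rintegral -[RHS]/(fine (nu A)%:E) -gE//; congr fine.
by apply: eq_integral => x /set_mem /AD Dk; rewrite (fE k).
Qed.

(** The one-sided bound for [f] and for [- f]; the resulting factor 2 is absorbed through
    [2 <= 2^p]. *)
Lemma local_density_weak_bound (nu : set T -> R) (f : T -> R) C : 0 < C ->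
  measurable_fun setT f -> local_density nu f -> weak_charge nu C ->
  weak_bound mu p f (2 * C).
Proof.
move=> C0 mf nuf nuC s s0.
have bp := local_density_upper_bound nuC (ltW C0) s0 mf nuf.
have nuCN : weak_charge (fun A => - nu A) C.
  split=> [A B fA fB AB|A fA]; last by rewrite normrN; exact: nuC.2.
  by rewrite nuC.1// opprD.
have mfN : measurable_fun setT (fun x => - f x) by exact: measurableT_comp.
have nufN : local_density (fun A => - nu A) (fun x => - f x).
  move=> k A mA AD; have [fint fA] := nuf k A mA AD; split.
    rewrite (_ : EFin \o _ = (fun x => - (EFin \o f) x)%E); last exact/funext.
    exact: integrableN.
  rewrite -fA -[RHS]mulN1r -RintegralZl//.
  by apply: eq_Rintegral => x _; rewrite mulN1r.
have bn := local_density_upper_bound nuCN (ltW C0) s0 mfN nufN.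
have -> : [set x | s < `|f x|] = [set x | s < f x] `|` [set x | s < - f x].
  apply/seteqP; split => x /=; rewrite ltr_normr; first by move=> /orP[]; [left|right].
  by move=> [->|->]; rewrite ?orbT.
apply: le_trans (measureU2 _ (measurable_gt s mf) (measurable_gt s mfN)) _.
apply: le_trans (leeD bp bn) _; rewrite -EFinD lee_fin -mulr2n -[leLHS]mulr_natl.
rewrite -(mulrA 2 C s^-1) [leRHS]powRM ?divr_ge0 ?(ltW C0) ?(ltW s0)//.
rewrite ler_wpM2r ?powR_ge0// -[leLHS]powRr1//.
by apply: ler_powR; [rewrite ler1n|exact: ltW].
Qed.

Lemma local_density_ae_unique (nu : set T -> R) (f g : T -> R) :
  measurable_fun setT f -> measurable_fun setT g ->
  local_density nu f -> local_density nu g -> f = g %[ae mu].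
Proof.
move=> mf mg nuf nug.
apply: (@negligibleS _ _ _ _
    (\bigcup_k ~` [set x | D k x -> (EFin \o f) x = (EFin \o g) x])).
  move=> x /= /existsNP[_ fgx]; have : (\bigcup_k D k) x by rewrite covD.
  by move=> [k _ Dk]; exists k => //= /(_ Dk) [].
apply: negligible_bigcup => k.
apply: (@integral_ae_eq _ _ _ mu (D k) (mD k)).
- by have [] := nuf k (D k) (mD k) (@subset_refl _ _).
- by apply/measurable_EFinP; exact: measurable_funS mg.
- move=> E ED mE; have [fi fE] := nuf k E mE ED; have [gi gE] := nug k E mE ED.
  have [ff gf] := (integrable_fin_num mE fi, integrable_fin_num mE gi).
  by rewrite -(fineK ff) -(fineK gf); congr (_%:E); rewrite -[LHS]/(Rintegral _ _ _) fE -gE.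
Qed.

Lemma local_density_linear (nu nu' nu'' : set T -> R) (f g : T -> R) a :
  (forall A, finite_measure_set A -> nu'' A = a * nu A + nu' A) ->
  local_density nu f -> local_density nu' g ->
  local_density nu'' (fun x => a * f x + g x).
Proof.
move=> nuE nuf nug k A mA AD; have [fi fE] := nuf k A mA AD.
have [gi gE] := nug k A mA AD.
have afi : mu.-integrable A (EFin \o (fun x => a * f x)).
  rewrite (_ : _ \o _ = (fun x => a%:E * (EFin \o f) x)%E); last exact/funext.
  exact: integrableZl.
split.
  rewrite (_ : _ \o _ = (EFin \o (fun x => (a * f x)%R)) \+ (EFin \o g))%E.
    exact: integrableD.
  exact/funext.
rewrite RintegralD// RintegralZl// fE gE nuE//.
by apply: finite_measure_setS AD _ => //; split.
Qed.

(** A Dynkin class argument inside each piece, for the difference [f - g]. It is needed because a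
    set function obtained as a limit over levels can be computed only on the sets of [G]. *)
Lemma local_density_ae_eq_on (G : set (set T)) (nu : set T -> R) (f g : T -> R) :
  measurable = <<s G >> -> setI_closed G ->
  measurable_fun setT f -> measurable_fun setT g ->
  (forall k, mu.-integrable (D k) (EFin \o f)) ->
  local_density nu g ->
  (forall k, \int[mu]_(x in D k) f x = nu (D k)) ->
  (forall k S, G S -> \int[mu]_(x in D k `&` S) f x = nu (D k `&` S)) ->
  g = f %[ae mu].
Proof.
move=> GE GI mf mg fi nug fD fG.
pose h x := f x - g x.
have mh : measurable_fun setT h by exact: measurable_funB.
have hi k : mu.-integrable (D k) (EFin \o h).
  rewrite (_ : _ \o _ = (EFin \o f) \- (EFin \o g))%E; last exact/funext.
  by apply: integrableB => //; have [] := nug k (D k) (mD k) (@subset_refl _ _).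
have DI k S : measurable S -> measurable (D k `&` S) by exact: measurableI.
have hiS k S : measurable S -> mu.-integrable (D k `&` S) (EFin \o h).
  by move=> mS; apply: integrableS (hi k) => //; exact: DI.
have hE k S : measurable S ->
    \int[mu]_(x in D k `&` S) f x = nu (D k `&` S) ->
    (\int[mu]_(x in D k `&` S) (EFin \o h) x = 0)%E.
  move=> mS fS; have [gi gS] := nug k (D k `&` S) (DI k S mS) (@subIsetl _ _ _).
  rewrite -(fineK (integrable_fin_num (DI k S mS) (hiS k S mS))).
  congr (_%:E); rewrite -[LHS]/(Rintegral _ _ h) RintegralB ?fS ?gS ?subrr//.
  - exact: DI.
  - by apply: integrableS (fi k) => //; exact: DI.
have hS k S : measurable S -> (\int[mu]_(x in D k `&` S) (EFin \o h) x = 0)%E.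
  move=> mS; move: (mS); rewrite GE => sGS.
  pose P U := measurable U -> (\int[mu]_(x in D k `&` U) (EFin \o h) x = 0)%E.
  apply: (@dynkin_induction _ _ G P) => //.
  - by move=> _; apply: hE => //; rewrite setIT.
  - by move=> U GU mU; apply: hE => //; exact: fG.
  - move=> U mU PU mUC; have := hE k setT measurableT.
    rewrite setIT fD => /(_ erefl).
    rewrite -{1}(setIT (D k)) -(setUv U) setIUr integral_setU_EFin//; last 4 first.
    + exact: DI.
    + exact: DI.
    + exact: measurable_funTS.
    + by apply/disj_set2P; rewrite setIACA setICr setI0.
    by rewrite PU// add0e.
  - move=> F mF tF PF mUF; rewrite setI_bigcupr integral_bigcup//.
    + by apply: eseries0 => i _ _; exact: PF.
    + apply/trivIsetP => i j _ _ ij; rewrite setIACA.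
      by move/trivIsetP : tF => /(_ i j Logic.I Logic.I ij) ->; rewrite setI0.
    + by move=> i; exact: DI.
    + by rewrite -setI_bigcupr; exact: hiS.
have h0 : local_density (fun=> 0) h.
  move=> k A mA AD; split; first exact: integrableS (hi k).
  by rewrite /Rintegral -(setIidr AD) [integral _ _ _]hS.
have z0 : local_density (fun=> 0) (cst 0 : T -> R).
  move=> k A mA AD; split; last by rewrite Rintegral_cst// mul0r.
  by rewrite (_ : _ \o _ = cst 0%E); [exact: integrable0|exact/funext].
have := local_density_ae_unique mh (measurable_cst _) h0 z0.
apply: filterS => x /(_ Logic.I) /eqP; rewrite /h subr_eq0 => /eqP e _.
by rewrite e.
Qed.

End Density.

Lemma bigsetU_condP (T : Type) (I : finType) (P : pred I) (A : I -> set T) x :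
  (\big[setU/set0]_(i | P i) A i) x <-> exists2 i, P i & A i x.
Proof.
split=> [|[i Pi Ai]]; last by rewrite (bigD1 i)//=; left.
elim/big_rec: _ => // i U Pi ih [Ai|/ih//].
by exists i.
Qed.

Lemma Rintegral_bigsetU d (T : measurableType d) (R : realType)
    (mu : {measure set T -> \bar R}) (I : finType) (P : pred I)
    (A : I -> set T) (f : T -> R) :
  (forall i, measurable (A i)) -> trivIset [set i | P i] A ->
  (forall i, P i -> mu.-integrable (A i) (EFin \o f)) -> measurable_fun setT f ->
  \int[mu]_(x in \big[setU/set0]_(i | P i) A i) f x =
  \sum_(i | P i) \int[mu]_(x in A i) f x.
Proof.
move=> mA tA fi mf; rewrite /Rintegral -big_filter.
set s := [seq i <- index_enum I | P i].
have sE : [set` s] = [set i | P i].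
  by apply/seteqP; split => i /=; rewrite mem_filter mem_index_enum andbT.
rewrite integral_bigsetU_EFin ?sE//; last 2 first.
- by rewrite filter_uniq// index_enum_uniq.
- by apply/measurable_EFinP; exact: (measurable_funS measurableT (@subsetT _ _) mf).
rewrite /s big_filter -sum_fine// => i Pi.
exact: (integrable_fin_num (mA i) (fi i Pi)).
Qed.

(** * The complemented embedding by blocks *)

Section BlockEmbedding.
Context d (T : measurableType d) d' (T' : measurableType d') (R : realType).
Variables (mu : {measure set T -> \bar R}) (mu' : {measure set T' -> \bar R}).
Variable p : R.
Hypothesis p1 : 1 < p.
Local Notation q := (p / (p - 1)).
Variables (D : nat -> set T) (G : set (set T)).
Hypothesis mD : forall k, measurable (D k).
Hypothesis Doo : forall k, (mu (D k) < +oo)%E.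
Hypothesis tD : trivIset setT D.
Hypothesis covD : \bigcup_k D k = setT.
Hypothesis GE : measurable = <<s G >>.
Hypothesis GI : setI_closed G.
(* Level [j] consists of [N j] atoms [A j i] of measure [delta j] in [T], matched
   with blocks [A' j i] of measure [a j] in [T']; the blocks of all levels are
   disjoint, whereas the levels of atoms refine each other on [G]. *)
Variables (N : nat -> nat) (delta a : nat -> R).
Variables (A : nat -> nat -> set T) (A' : nat -> nat -> set T').
Hypothesis delta0 : forall j, 0 < delta j.
Hypothesis mA : forall j i, measurable (A j i).
Hypothesis tA : forall j i i' x, A j i x -> A j i' x -> i = i'.
Hypothesis muA : forall j i, (i < N j)%N -> mu (A j i) = (delta j)%:E.
Hypothesis GA : forall k S, G S \/ S = setT -> \forall j \near \oo,
  exists P : pred nat,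
    D k `&` S = \big[setU/set0]_(i < N j | P i) A j i.
Hypothesis a0 : forall j, 0 < a j.
Hypothesis mA' : forall j i, measurable (A' j i).
Hypothesis tA' : forall j i j' i' y, (i < N j)%N -> (i' < N j')%N ->
  A' j i y -> A' j' i' y -> j = j' /\ i = i'.
Hypothesis muA' : forall j i, (i < N j)%N -> mu' (A' j i) = (a j)%:E.
(* The number of blocks of small measure is controlled, so that superposing all
   levels costs only a constant factor in the weak norm. *)
Hypothesis lacunary : forall n s, 0 < s ->
  \sum_(j < n | a j <= s) Num.min s ((N j)%:R * a j) <= 2 * s.

(* [tau j] is the factor by which dilating the measure by [c j] multiplies the
   weak norm; dividing by it makes every level of [spread] a contraction. *)
Let c j := a j / delta j.
Let tau j := c j `^ p^-1.

Let c0 j : 0 < c j. Proof. by rewrite divr_gt0. Qed.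
Let tau0 j : 0 < tau j. Proof. by rewrite powR_gt0. Qed.
Let tau_p j : tau j `^ p = c j.
Proof.
rewrite -powRrM mulVf ?powRr1 ?gt_eqF//; first exact: ltW.
exact: lt_trans p1.
Qed.
Let tau_q j : tau j * c j `^ q^-1 = c j.
Proof. by rewrite /tau -powR_conj// ltW. Qed.

Let idx_exists : exists idx : T' -> nat * nat,
  (forall j i y, (i < N j)%N -> A' j i y -> idx y = (j, i)) /\
  (forall y, ((idx y).2 < N (idx y).1)%N -> A' (idx y).1 (idx y).2 y).
Proof.
have H y : exists ji : nat * nat,
    (forall j i, (i < N j)%N -> A' j i y -> ji = (j, i)) /\
    ((ji.2 < N ji.1)%N -> A' ji.1 ji.2 y).
  have [[ji [jiN jiA]]|nji] :=
      pselect (exists ji, (ji.2 < N ji.1)%N /\ A' ji.1 ji.2 y).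
    exists ji; split => // j i iN Ay; case: ji jiN jiA => j' i' /= iN' Ay'.
    by have [-> ->] := tA' iN' iN Ay' Ay.
  (* Default address for a point outside all blocks: its second entry is out of range, so
     [(idx y).2 < N (idx y).1] expresses that [y] lies in a block. *)
  exists (0%N, N 0%N); split => /= [j i iN Ay|]; last by rewrite ltnn.
  by exfalso; apply: nji; exists (j, i).
have [idx Hidx] := choice H.
exists idx; split=> [j i y iN Ay|y]; last by case: (Hidx y).
by case: (Hidx y) => h _; exact: h.
Qed.

Section Spread.
Variable idx : T' -> nat * nat.
Hypothesis idxE : forall j i y, (i < N j)%N -> A' j i y -> idx y = (j, i).
Hypothesis idxA : forall y, ((idx y).2 < N (idx y).1)%N -> A' (idx y).1 (idx y).2 y.

Let coef (f : T -> R) j i := (tau j * delta j)^-1 * \int[mu]_(x in A j i) f x.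

Let spread (f : T -> R) (y : T') : R :=
  if ((idx y).2 < N (idx y).1)%N then coef f (idx y).1 (idx y).2 else 0.

Let spreadE f j i y : (i < N j)%N -> A' j i y -> spread f y = coef f j i.
Proof. by move=> iN Ay; rewrite /spread (idxE iN Ay) /= iN. Qed.

Let measurable_spread f : measurable_fun setT (spread f).
Proof.
move=> _ Y mY; rewrite setTI.
pose U (P : nat -> nat -> Prop) :=
  \bigcup_j \bigcup_(i in [set i | (i < N j)%N /\ P j i]) A' j i.
have mU P : measurable (U P).
  by apply: bigcupT_measurable => j; apply: bigcup_measurable => i _.
have spread0 y : ~ U (fun _ _ => True) y -> spread f y = 0.
  move=> nU; rewrite /spread; case: ifPn => // iN; exfalso; apply: nU.
  by exists (idx y).1 => //; exists (idx y).2 => //; exact: idxA.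
have spreadN y : U (fun _ _ => True) y ->
    exists j i, [/\ (i < N j)%N, A' j i y & spread f y = coef f j i].
  by move=> [j _ [i [iN _] Ay]]; exists j, i; split => //; exact: spreadE.
have -> : spread f @^-1` Y = U (fun j i => Y (coef f j i)) `|`
    (~` U (fun _ _ => True) `&` [set y | Y 0]).
  apply/seteqP; split => [y /= Yy|y].
    have [Uy|nU] := pselect (U (fun _ _ => True) y).
      left; have [j [i [iN Ay e]]] := spreadN y Uy.
      by exists j => //; exists i => //; split => //; rewrite -e.
    by right; split => //=; rewrite -(spread0 y nU).
  move=> [[j _ [i [iN Yc] Ay]]|[nU /= Y0]] /=; first by rewrite (spreadE f iN Ay).
  by rewrite spread0.
apply: measurableU => //; apply: measurableI; first exact: measurableC.
have [Y0|Y0] := pselect (Y 0).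
  rewrite (_ : [set _ | _] = setT); first exact: measurableT.
  by apply/seteqP; split.
rewrite (_ : [set _ | _] = set0); first exact: measurable0.
by apply/seteqP; split.
Qed.

(* The atoms of level [j] on which the average of [f] is large fill a set of
   measure [<= (K / s)^p] in [T'], and there are none unless [a j <= (K / s)^p]. *)
Let spread_level (f : T -> R) (K s : R) j : 0 < K -> 0 < s ->
  measurable_fun setT f -> (weak_norm mu p f <= K%:E)%E ->
  #|[set i : 'I_(N j) | s < `|coef f j i|]%SET|%:R * a j <=
  if a j <= (K / s) `^ p then Num.min ((K / s) `^ p) ((N j)%:R * a j) else 0.
Proof.
move=> K0 s0 mf fK; set I := [set i : 'I_(N j) | _]%SET; set n := #|I|.
have td0 : 0 < tau j * delta j by rewrite mulr_gt0.
have H : n%:R * a j <= (K / s) `^ p.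
  (* The bound is first obtained in [T], on the union of the selected atoms; multiplying by [c j],
     which is [tau j ^ p], carries it to the blocks. *)
  have sc : n%:R * delta j <= (K / (s * tau j)) `^ p.
    apply: weak_bound_of_strong => //.
    - by rewrite mulr_ge0// ltW.
    - by rewrite mulr_gt0.
    - exact: ltW.
    have tAI : trivIset [set` I] (fun i : 'I_(N j) => A j i).
      by move=> i i' _ _ [x [Ax Ax']]; apply: val_inj; exact: tA Ax Ax'.
    have SN := sum_norm_Rintegral_le mf fK (fun i : 'I_(N j) => mA j i) tAI
      (fun i _ => muA (ltn_ord i)).
    apply: le_trans SN.
    have -> : s * tau j * (n%:R * delta j) = \sum_(i in I) s * (tau j * delta j).
      by rewrite sumr_const -mulr_natl -/n; ring.
    apply: ler_sum => i; rewrite inE /coef normrM ger0_norm ?invr_ge0 ?(ltW td0)//.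
    by rewrite mulrC ltr_pdivlMr// => /ltW.
  have -> : n%:R * a j = n%:R * delta j * c j.
    by rewrite /c -mulrA; congr (_ * _); rewrite mulrCA divff ?mulr1// gt_eqF.
  have -> : (K / s) `^ p = (K / (s * tau j)) `^ p * c j.
    rewrite -(tau_p j) -powRM ?divr_ge0 ?mulr_ge0 ?(ltW K0) ?(ltW s0) ?(ltW (tau0 j))//.
    by congr (_ `^ p); rewrite invfM mulrA mulfVK// gt_eqF.
  by rewrite ler_wpM2r// ltW.
have [n0|n0] := posnP n.
  rewrite n0 mul0r; case: ifP => // _.
  by rewrite le_min powR_ge0 mulr_ge0// ltW.
(* A single selected atom already forces [a j <= (K / s)^p]. *)
have aj : a j <= n%:R * a j by rewrite ler_peMl ?ler1n// ltW.
rewrite (le_trans aj H) le_min H/= ler_wpM2r ?(ltW (a0 j))// ler_nat.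
by rewrite -[leqRHS]card_ord max_card.
Qed.

(** The level bounds are exactly the terms of [lacunary] at the scale [(K / s)^p]; its factor 2 is
    absorbed through [2 <= 2^p]. *)
Let spread_bound (f : T -> R) K : 0 < K -> measurable_fun setT f ->
  (weak_norm mu p f <= K%:E)%E -> weak_bound mu' p (spread f) (2 * K).
Proof.
move=> K0 mf fK s s0; set sig := (K / s) `^ p.
have sig0 : 0 < sig by rewrite powR_gt0// divr_gt0.
pose U j := \big[setU/set0]_(i < N j | s < `|coef f j i|) A' j i.
have mU j : measurable (U j) by exact: bigsetU_measurable.
have muU j : mu' (U j) =
    (#|[set i : 'I_(N j) | s < `|coef f j i|]%SET|%:R * a j)%:E.
  rewrite measure_bigsetU_ord_cond//; last first.
    move=> i i' _ _ [y [Ay Ay']]; apply: val_inj.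
    by have [] := tA' (ltn_ord i) (ltn_ord i') Ay Ay'.
  rewrite (eq_bigr (fun=> (a j)%:E)); last by move=> i _; exact: muA'.
  rewrite sumEFin -sum1_card natr_sum mulr_suml; congr (_%:E).
  by apply: eq_big => [i|i _]; rewrite ?inE ?mul1r.
have sU : [set y | s < `|spread f y|] `<=` \bigcup_j U j.
  move=> y /=; rewrite {1}/spread; case: ifPn => [iN sy|_]; last first.
    by rewrite normr0 ltNge ltW.
  exists (idx y).1 => //; rewrite /U (bigD1 (Ordinal iN))//=.
  by left; exact: idxA.
apply: (@le_trans _ _ (mu' (\bigcup_j U j))).
  apply: le_measure; rewrite ?inE//; last exact: bigcupT_measurable.
  by apply: measurable_gt_norm; exact: measurable_spread.
apply: le_trans (@generalized_Boole_inequality _ _ _ mu' U mU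
  (bigcupT_measurable U mU)) _.
apply: lime_le; first exact: is_cvg_nneseries.
apply: nearW => n; rewrite big_mkord.
apply: (@le_trans _ _ (2 * sig)%:E); last first.
  rewrite lee_fin -mulrA [leRHS]powRM ?divr_ge0 ?(ltW K0) ?(ltW s0)//.
  rewrite ler_wpM2r ?powR_ge0// -[leLHS]powRr1//.
  by apply: ler_powR; [rewrite ler1n|exact: ltW].
apply: le_trans (_ : (\sum_(j < n)
    (if a j <= sig then Num.min sig ((N j)%:R * a j) else 0)%:E <= _)%E).
  by apply: lee_sum => j _; rewrite muU lee_fin; exact: spread_level.
by rewrite sumEFin lee_fin -big_mkcond; exact: lacunary.
Qed.

Let spread_linear b (f g : weakLp_fun mu p) :
  spread (b *: f + g) = (fun y => b * spread f y + spread g y) %[ae mu'].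
Proof.
apply: aeW => y _; rewrite /spread; case: ifP => [iN|_]; last first.
  by rewrite mulr0 addr0.
have [K K0 fK] := weakLp_fun_norm f; have [L L0 gL] := weakLp_fun_norm g.
have Aoo : (mu (A (idx y).1 (idx y).2) < +oo)%E by rewrite muA// ltry.
have fi := weak_norm_integrable (weakLp_fun_measurable f) fK (mA (idx y).1 (idx y).2) Aoo.
have gi := weak_norm_integrable (weakLp_fun_measurable g) gL (mA (idx y).1 (idx y).2) Aoo.
rewrite /coef mulrCA -mulrDr; congr (_ * _).
rewrite -RintegralZl// -RintegralD//.
rewrite (_ : _ \o _ = (fun x => b%:E * (EFin \o f) x)%E); last exact/funext.
exact: integrableZl.
Qed.

Let spread_operator :
  exists2 Phi : {linear weakLp mu p -> weakLp mu' p}, continuous Phi &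
    forall f : weakLp_fun mu p,
      exists2 h : weakLp_fun mu' p, (h : T' -> R) = spread f &
        Phi (\pi_(weakLp mu p) f)%qT = (\pi_(weakLp mu' p) h)%qT.
Proof.
apply: (weakLp_operator p1 (F := spread) (ltr0n R 2)).
- by move=> f; exact: measurable_spread.
- by move=> f K K0; apply: spread_bound => //; exact: weakLp_fun_measurable.
- exact: spread_linear.
Qed.

(* [gather_level] inverts [spread] up to averaging over the atoms of level [j], and
   averaging is exact, for [j] large, on the sets of [G]. *)
Variable L : (nat -> R) -> R.
Hypothesis L_linear : forall b u v (M : R), (forall j, `|u j| <= M) ->
  (forall j, `|v j| <= M) -> L (fun j => b * u j + v j) = b * L u + L v.
Hypothesis L_bound : forall u (M : R), (forall j, `|u j| <= M) -> `|L u| <= M.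
Hypothesis L_eventually : forall u b, (\forall j \near \oo, u j = b) -> L u = b.

Let gather_level (g : T' -> R) j (S : set T) : R :=
  \sum_(i < N j)
    tau j / a j * \int[mu']_(x in A' j i) g x * fine (mu (S `&` A j i)).

Let gather (g : T' -> R) (S : set T) := L (fun j => gather_level g j S).

Let muSA S j i : measurable S -> (i < N j)%N ->
  mu (S `&` A j i) \is a fin_num /\ fine (mu (S `&` A j i)) <= delta j.
Proof.
move=> mS iN; have le : (mu (S `&` A j i) <= (delta j)%:E)%E.
  by rewrite -(muA iN); apply: le_measure; rewrite ?inE//; exact: measurableI.
have fin : mu (S `&` A j i) \is a fin_num.
  by rewrite ge0_fin_numE//; exact: le_lt_trans le (ltry _).
by split => //; rewrite -lee_fin fineK.
Qed.

Let sum_muSA S j : finite_measure_set mu S ->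
  \sum_(i < N j) fine (mu (S `&` A j i)) <= fine (mu S).
Proof.
move=> [mS Soo].
rewrite -lee_fin fineK ?ge0_fin_numE// -sumEFin.
rewrite (eq_bigr (fun i : 'I_(N j) => mu (S `&` A j i))); last first.
  by move=> i _; rewrite fineK//; case: (muSA mS (ltn_ord i)).
have mSA i : measurable (S `&` A j i) by exact: measurableI.
rewrite -(@measure_bigsetU_ord_cond _ _ _ mu (N j) xpredT (fun i => S `&` A j i)).
- apply: le_measure; rewrite ?inE//; first exact: bigsetU_measurable.
  by move=> x; rewrite -(bigcup_mkord _ (fun i => S `&` A j i)) => -[i _ []].
- by [].
- move=> i i' _ _ [x [[_ Ax] [_ Ax']]]; apply: val_inj; exact: tA Ax Ax'.
Qed.

(** The bound has to be uniform in [j] for the limit. The fractions of the atoms lying in [S] are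
    weights in [0, 1] for [sum_weighted_le]; the powers of [a j] and [delta j] then cancel because
    [tau j * c j ^ (1/q)] equals [c j]. *)
Let gather_level_bound (g : T' -> R) K S j : 0 <= K -> measurable_fun setT g ->
  (weak_norm mu' p g <= K%:E)%E -> finite_measure_set mu S ->
  `|gather_level g j S| <= 2 * K * fine (mu S) `^ q^-1.
Proof.
move=> K0 mg gK fS; have [mS Soo] := fS.
pose w (i : 'I_(N j)) := fine (mu (S `&` A j i)) / delta j.
pose H (i : 'I_(N j)) := `|\int[mu']_(x in A' j i) g x|.
have w01 i : 0 <= w i <= 1.
  rewrite /w divr_ge0 ?fine_ge0 ?(ltW (delta0 j))//=.
  rewrite ler_pdivrMr// mul1r.
  by case: (muSA mS (ltn_ord i)).
have HD (I : {set 'I_(N j)}) :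
    \sum_(i in I) H i <= K * a j `^ q^-1 * #|I|%:R `^ q^-1.
  have tAI : trivIset [set` I] (fun i : 'I_(N j) => A' j i).
    move=> i i' _ _ [y [Ay Ay']]; apply: val_inj.
    by have [] := tA' (ltn_ord i) (ltn_ord i') Ay Ay'.
  have := sum_norm_Rintegral_le mg gK (fun i : 'I_(N j) => mA' j i) tAI
      (fun i _ => muA' (ltn_ord i)).
  by rewrite powRM ?(ltW (a0 j))// mulrAC mulrA.
have Ka0 : 0 <= K * a j `^ q^-1 by rewrite mulr_ge0// powR_ge0.
have H0 i : 0 <= H i by exact: normr_ge0.
have le := sum_weighted_le p1 Ka0 w01 H0 HD.
have ta0 : 0 < tau j / a j by rewrite divr_gt0.
have dN0 := lt0r_neq0 (delta0 j); have aN0 := lt0r_neq0 (a0 j).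
apply: (@le_trans _ _ (tau j / a j * delta j * \sum_i w i * H i)).
  apply: le_trans (ler_norm_sum _ _ _) _; rewrite mulr_sumr.
  apply: ler_sum => i _; rewrite 2!normrM (ger0_norm (ltW ta0)).
  rewrite [X in _ * X <= _]ger0_norm ?fine_ge0// /w -/(H i).
  by rewrite le_eqVlt; apply/orP; left; apply/eqP; field; rewrite aN0 dN0.
have q0 := ltW (conj_inv_gt0 p1).
have sw : \sum_i w i <= fine (mu S) / delta j.
  by rewrite -mulr_suml ler_pM2r ?invr_gt0//; exact: sum_muSA.
have sw0 : 0 <= \sum_i w i by apply: sumr_ge0 => i _; case/andP: (w01 i).
have m0 : 0 <= fine (mu S) by rewrite fine_ge0.
apply: (@le_trans _ _ (tau j / a j * delta j *
    (2 * (K * a j `^ q^-1) * (fine (mu S) / delta j) `^ q^-1))).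
  apply: ler_wpM2l; first by rewrite mulr_ge0// ltW.
  apply: le_trans le _; apply: ler_wpM2l; first by rewrite mulr_ge0.
  by apply: ge0_ler_powR; rewrite // nnegrE// divr_ge0// ltW.
have -> : 2 * (K * a j `^ q^-1) * (fine (mu S) / delta j) `^ q^-1 =
    2 * K * fine (mu S) `^ q^-1 * c j `^ q^-1.
  have -> : 2 * (K * a j `^ q^-1) * (fine (mu S) / delta j) `^ q^-1 =
    2 * K * (a j `^ q^-1 * (fine (mu S) / delta j) `^ q^-1) by ring.
  rewrite -powRM ?divr_ge0 ?(ltW (a0 j)) ?(ltW (delta0 j))//.
  rewrite -[RHS]mulrA -powRM ?(ltW (c0 j))//; congr (_ * _ `^ _).
  by rewrite /c; ring.
rewrite le_eqVlt; apply/orP; left; apply/eqP.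
transitivity (tau j * c j `^ q^-1 * (delta j / a j) *
  (2 * K * fine (mu S) `^ q^-1)); first by ring.
by rewrite tau_q /c; field; rewrite aN0 dN0.
Qed.

Let gather_weak_charge (g : T' -> R) K : 0 <= K -> measurable_fun setT g ->
  (weak_norm mu' p g <= K%:E)%E -> weak_charge mu p (gather g) (2 * K).
Proof.
move=> K0 mg gK; split => [S S' fS fS' SS'|S fS].
  pose M := 2 * K * fine (mu S) `^ q^-1 + 2 * K * fine (mu S') `^ q^-1.
  rewrite /gather -[L (fun j => gather_level g j S)]mul1r.
  rewrite -(@L_linear 1 _ _ M) => [|j|j]; last 2 first.
  - apply: le_trans (gather_level_bound j K0 mg gK fS) _.
    by rewrite lerDl mulr_ge0 ?powR_ge0// mulr_ge0.
  - apply: le_trans (gather_level_bound j K0 mg gK fS') _.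
    by rewrite lerDr mulr_ge0 ?powR_ge0// mulr_ge0.
  congr L; apply/funext => j; rewrite mul1r -big_split/=.
  apply: eq_bigr => i _; rewrite -mulrDr; congr (_ * _).
  have [mS _] := fS; have [mS' _] := fS'.
  rewrite setIUl measureU ?fineD//.
  - by case: (muSA mS (ltn_ord i)).
  - by case: (muSA mS' (ltn_ord i)).
  - exact: measurableI.
  - exact: measurableI.
  - by rewrite setIACA SS' set0I.
by apply: L_bound => j; exact: gather_level_bound.
Qed.

Let gather_linear b (f g : weakLp_fun mu' p) S : finite_measure_set mu S ->
  gather (b *: f + g) S = b * gather f S + gather g S.
Proof.
move=> fS; have [K K0 fK] := weakLp_fun_norm f; have [M M0 gM] := weakLp_fun_norm g.
have mf := weakLp_fun_measurable f; have mg := weakLp_fun_measurable g.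
pose X := 2 * K * fine (mu S) `^ q^-1 + 2 * M * fine (mu S) `^ q^-1.
rewrite /gather -(@L_linear b _ _ X) => [|j|j]; last 2 first.
- apply: le_trans (gather_level_bound j K0 mf fK fS) _.
  by rewrite lerDl mulr_ge0 ?powR_ge0// mulr_ge0.
- apply: le_trans (gather_level_bound j M0 mg gM fS) _.
  by rewrite lerDr mulr_ge0 ?powR_ge0// mulr_ge0.
congr L; apply/funext => j; rewrite mulr_sumr -big_split/=.
apply: eq_bigr => i _; rewrite mulrA -mulrDl; congr (_ * _).
rewrite mulrCA -mulrDr; congr (_ * _).
have Aoo : (mu' (A' j i) < +oo)%E by rewrite muA'// ltry.
have fi := weak_norm_integrable mf fK (mA' j i) Aoo.
have gi := weak_norm_integrable mg gM (mA' j i) Aoo.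
rewrite -RintegralZl// -RintegralD//.
rewrite (_ : _ \o _ = (fun x => b%:E * (EFin \o f) x)%E); last exact/funext.
exact: integrableZl.
Qed.

Let gather_exists : exists H : weakLp_fun mu' p -> T -> R, forall g,
  measurable_fun setT (H g) /\ local_density mu D (gather g) (H g).
Proof.
have ex (g : weakLp_fun mu' p) : exists h : T -> R,
    measurable_fun setT h /\ local_density mu D (gather g) h.
  have [K K0 gK] := weakLp_fun_norm g.
  have [h mh hg] := weak_charge_density p1 mD Doo tD covD
    (gather_weak_charge K0 (weakLp_fun_measurable g) gK).
  by exists h.
by have [H HH] := choice ex; exists H.
Qed.

Section Gather.
Variable H : weakLp_fun mu' p -> T -> R.
Hypothesis mH : forall g : weakLp_fun mu' p, measurable_fun setT (H g).
Hypothesis HE : forall g : weakLp_fun mu' p, local_density mu D (gather g) (H g).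

(** The densities [H g] are chosen independently, so linearity holds only up to null sets, by
    uniqueness. One factor 2 comes from [gather_weak_charge], the other from the two signs in
    [local_density_weak_bound]. *)
Let gather_operator :
  exists2 Phi : {linear weakLp mu' p -> weakLp mu p}, continuous Phi &
    forall f : weakLp_fun mu' p,
      exists2 h : weakLp_fun mu p, (h : T -> R) = H f &
        Phi (\pi_(weakLp mu' p) f)%qT = (\pi_(weakLp mu p) h)%qT.
Proof.
apply: (weakLp_operator p1 (F := H) (C := 2 * 2)) => //.
- move=> f K K0 fK; rewrite -mulrA; apply: (local_density_weak_bound p1 mD Doo tD covD _ _ (HE f)) => //.
    by rewrite mulr_gt0.
  by apply: gather_weak_charge => //; exact: ltW.
- move=> b f g; apply: (local_density_ae_unique mD covD _ _ (HE _)) => //.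
    by apply: measurable_funD => //; exact: measurable_funM.
  apply: (local_density_linear mD Doo _ (HE f) (HE g)) => S fS.
  exact: gather_linear.
Qed.

(** On an atom of level [j] the normalisations cancel, so [gather_level] returns exactly the
    integral of [f]. For [S] in [G], the set [D k] cut by [S] is a union of such atoms for all large
    [j], and the sequence under [L] is eventually constant. *)
Let gather_spread (f : weakLp_fun mu p) (h : weakLp_fun mu' p) :
  (h : T' -> R) = spread f -> H h = f %[ae mu].
Proof.
move=> hE; have [K K0 fK] := weakLp_fun_norm f.
have mf := weakLp_fun_measurable f.
have mG S : G S -> measurable S by rewrite GE; exact: sub_gen_smallest.
have key k S : G S \/ S = setT ->
    \int[mu]_(x in D k `&` S) f x = gather h (D k `&` S).
  move=> GS; apply/esym/L_eventually; apply: filterS (GA k GS) => j [P DS].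
  rewrite DS Rintegral_bigsetU//; last 2 first.
  - by move=> i i' _ _ [x [Ax Ax']]; apply: val_inj; exact: tA Ax Ax'.
  - by move=> i _; apply: weak_norm_integrable fK _ _; rewrite // muA// ltry.
  rewrite [RHS]big_mkcond/=; apply: eq_bigr => i _.
  have -> : (\big[setU/set0]_(i0 < N j | P i0) A j i0) `&` A j i =
      if P i then A j i else set0.
    apply/seteqP; split => x.
      move=> [/bigsetU_condP [i' Pi' Ax'] Ax].
      by rewrite (tA Ax Ax') Pi'.
    case: ifPn => // Pi Ax; split => //.
    by apply/bigsetU_condP; exists i.
  case: ifPn => [Pi|_]; last by rewrite measure0 mulr0.
  rewrite muA//= (@eq_Rintegral _ _ _ _ _ (cst (coef f j i))); last first.
    by move=> y /set_mem Ay; rewrite hE; exact: spreadE.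
  rewrite Rintegral_cst// muA'//= /coef; field.
  by rewrite !lt0r_neq0.
apply: (local_density_ae_eq_on mD covD GE GI) => //.
- by move=> k; apply: weak_norm_integrable fK _ _.
- by move=> k; have := key k setT (or_intror erefl); rewrite setIT.
- by move=> k S GS; apply: key; left.
Qed.

Lemma gather_complemented : complemented (weakLp mu p) (weakLp mu' p).
Proof.
have [Phi cPhi PhiE] := spread_operator; have [Psi cPsi PsiE] := gather_operator.
exists Phi, Psi; split => // u; rewrite -[u]reprK.
have [h hE ->] := PhiE (repr u); have [g gE ->] := PsiE h.
by apply/weakLp_eqP; rewrite gE; exact: gather_spread.
Qed.

End Gather.
Lemma spread_complemented : complemented (weakLp mu p) (weakLp mu' p).
Proof.
have [H HH] := gather_exists.
by apply: (@gather_complemented H) => g; case: (HH g).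
Qed.

End Spread.

Lemma complemented_of_blocks : complemented (weakLp mu p) (weakLp mu' p).
Proof.
have [idx [idxE idxA]] := idx_exists.
have [L [L1 L2 L3]] := @generalized_limit R.
exact: (spread_complemented idxE idxA L1 L2 L3).
Qed.

End BlockEmbedding.

(** * Lacunary scales and the blocks in the two targets *)

Section Blocks.
Context {R : realType}.
Variable N : nat -> nat.

(** Level [j] will occupy the interval from [a j] to [a j * (N j + 1)], cut into [N j] blocks of
    length [a j]. With factors [N i + 1], neighbouring levels are adjacent. *)
Definition block_scale (n : nat) : nat := \prod_(i < n) (N i).+1.
Local Notation b := block_scale.

Lemma block_scaleS n : b n.+1 = (b n * (N n).+1)%N.
Proof. by rewrite /b big_ord_recr. Qed.

Lemma block_scale_gt0 n : (0 < b n)%N.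
Proof. by rewrite prodn_gt0. Qed.

Lemma block_scale_le m n : (m <= n)%N -> (b m <= b n)%N.
Proof.
move=> mn; rewrite -(subnK mn); elim: (n - m)%N => // k ih.
by rewrite addSn block_scaleS (leq_trans ih)// leq_pmulr.
Qed.

Lemma blocks_disjoint (a : nat -> R) : (forall j, 0 < a j) ->
  (forall j j', (j < j')%N ->
    a j * (N j).+1%:R <= a j' \/ a j' * (N j').+1%:R <= a j) ->
  forall j i j' i' x, (i < N j)%N -> (i' < N j')%N ->
    a j * i.+1%:R <= x < a j * i.+2%:R ->
    a j' * i'.+1%:R <= x < a j' * i'.+2%:R -> j = j' /\ i = i'.
Proof.
move=> a0 sep.
have lo j i x : a j * i.+1%:R <= x -> a j <= x.
  by apply: le_trans; rewrite ler_peMr ?ler1n// ltW.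
have hi j i x : (i < N j)%N -> x < a j * i.+2%:R -> x < a j * (N j).+1%:R.
  by move=> iN /lt_le_trans; apply; rewrite ler_pM2l// ler_nat.
have neq j i j' i' x : (i < N j)%N -> (i' < N j')%N ->
    a j * i.+1%:R <= x < a j * i.+2%:R ->
    a j' * i'.+1%:R <= x < a j' * i'.+2%:R -> ~ (j < j')%N.
  move=> iN iN' /andP[l h] /andP[l' h'] /sep[] s.
    by have := lt_le_trans (hi _ _ _ iN h) (le_trans s (lo _ _ _ l')); rewrite ltxx.
  by have := lt_le_trans (hi _ _ _ iN' h') (le_trans s (lo _ _ _ l)); rewrite ltxx.
have eqi j i i' x : a j * i.+1%:R <= x < a j * i.+2%:R ->
    a j * i'.+1%:R <= x < a j * i'.+2%:R -> ~ (i < i')%N.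
  move=> /andP[_ h] /andP[l' _] ii'.
  have := lt_le_trans h (le_trans _ l'); rewrite ltxx => H.
  by apply/notF/H; rewrite ler_pM2l// ler_nat.
move=> j i j' i' x iN iN' h h'.
have jj' : j = j'.
  by case: (ltngtP j j') => // lt; exfalso; [exact: neq h h' lt|exact: neq h' h lt].
split => //; rewrite -{}jj' in iN' h' *.
by case: (ltngtP i i') => // lt; exfalso; [exact: eqi h h' lt|exact: eqi h' h lt].
Qed.

(** Since [N j * a j] is [a j.+1 - a j], the levels before the last one with [a j <= s] telescope to
    at most [a j], hence at most [s]; that last level costs at most [s] by the minimum. *)
Lemma lacunary_increasing (a : nat -> R) : (forall j, 0 < a j) ->
  (forall j, a j.+1 = a j * (N j).+1%:R) ->
  forall n s, 0 < s ->
    \sum_(j < n | a j <= s) Num.min s ((N j)%:R * a j) <= 2 * s.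
Proof.
move=> a0 aS n s s0.
suff [] : (a n <= s -> \sum_(j < n | a j <= s) Num.min s ((N j)%:R * a j) <= a n)
  /\ \sum_(j < n | a j <= s) Num.min s ((N j)%:R * a j) <= 2 * s by [].
have aSE j : a j.+1 = a j + (N j)%:R * a j by rewrite aS -natr1; ring.
elim: n => [|n [ih1 ih2]].
  by rewrite !big_ord0; split; [move=> _; exact: ltW|rewrite mulr_ge0// ltW].
rewrite big_mkcond big_ord_recr/= -big_mkcond/=.
case: (leP (a n) s) => [ans|san]; last first.
  rewrite addr0; split=> // aSs; exfalso.
  have : a n <= s by apply: le_trans aSs; rewrite aSE lerDl mulr_ge0// ltW.
  by rewrite leNgt san.
have {}ih1 := ih1 ans; split=> [_|].
  by rewrite aSE lerD// ge_min lexx orbT.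
have -> : 2 * s = s + s by ring.
by apply: lerD; [exact: le_trans ih1 ans|rewrite ge_min lexx].
Qed.

(** Here the first level with [a j <= s] costs at most [s], and all later ones telescope to at most
    [a j]. *)
Lemma lacunary_decreasing (a : nat -> R) : (forall j, 0 < a j) ->
  (forall j, a j = a j.+1 * (N j.+1).+1%:R) ->
  forall n s, 0 < s ->
    \sum_(j < n | a j <= s) Num.min s ((N j)%:R * a j) <= 2 * s.
Proof.
move=> a0 aS n s s0; case: n => [|n].
  by rewrite big_ord0 mulr_ge0// ltW.
have aSE j : a j = a j.+1 + (N j.+1)%:R * a j.+1 by rewrite aS -natr1; ring.
(* The summand [a n] is what remains of the telescoping sum for the levels to come; in the other
   branch no level has been counted yet. *)
suff : if a n <= s then
    \sum_(j < n.+1 | a j <= s) Num.min s ((N j)%:R * a j) + a n <= 2 * s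
    else \sum_(j < n.+1 | a j <= s) Num.min s ((N j)%:R * a j) == 0.
  case: ifP => _; last by move=> /eqP ->; rewrite mulr_ge0// ltW.
  by apply: le_trans; rewrite lerDl ltW.
have min_le j : Num.min s ((N j)%:R * a j) <= s by rewrite ge_min lexx.
have two : 2 * s = s + s by ring.
elim: n => [|n ih].
  rewrite big_mkcond big_ord_recr/= big_ord0 add0r.
  by case: (leP (a 0%N) s) => as0; rewrite ?eqxx// two lerD.
rewrite big_mkcond big_ord_recr/= -big_mkcond/=.
case: (leP (a n.+1) s) => [ans|san].
  case: (leP (a n) s) ih => [an ih|an /eqP ->]; last first.
    by rewrite add0r two lerD.
  apply: le_trans ih; rewrite -addrA lerD2l [leRHS]aSE addrC lerD2l.
  by rewrite ge_min lexx orbT.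
case: (leP (a n) s) ih => [an ih|an /eqP ->]; last by rewrite addr0.
exfalso; have : a n.+1 <= s by apply: le_trans an; rewrite [leRHS]aSE lerDl mulr_ge0// ltW.
by rewrite leNgt san.
Qed.

End Blocks.

Lemma counting_set1 {R : realType} (n : nat) : counting [set n] = 1%E :> \bar R.
Proof.
rewrite /counting asboolT; last exact: finite_set1.
by rewrite fset_set1 finmap.cardfs1.
Qed.

Lemma counting_itv {R : realType} (lo m : nat) :
  counting [set n | (lo <= n < lo + m)%N] = m%:R%:E :> \bar R.
Proof.
elim: m => [|m ih].
  rewrite (_ : [set _ | _] = set0) ?measure0//.
  apply/seteqP; split => // n /=; rewrite addn0 => /andP[h1 h2].
  by have := leq_ltn_trans h1 h2; rewrite ltnn.
rewrite (_ : [set _ | _] = [set n | (lo <= n < lo + m)%N] `|` [set (lo + m)%N]).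
  rewrite measureU//; last first.
    by apply/seteqP; split => // n [/= /andP[_ h] e]; move: h; rewrite e ltnn.
  by rewrite [X in (X + _)%E]ih [X in (_ + X)%E]counting_set1 -EFinD natr1.
apply/seteqP; split => n /=.
  move=> /andP[h]; rewrite addnS ltnS leq_eqVlt => /orP[/eqP ->|h']; first by right.
  by left; rewrite h.
move=> [/andP[h h']|->]; last by rewrite leq_addr addnS ltnSn.
by rewrite h addnS ltnS ltnW.
Qed.

Section SequenceAndUnitInterval.
Context {R : realType}.

(** The measure is restricted instead of the space, so that affine maps remain total functions on
    the line. *)
Definition lebesgue_on (J : set (measurableTypeR R)) (mJ : measurable J) :
  {measure set (measurableTypeR R) -> \bar R} := mrestr (@lebesgue_measure R) mJ.

Definition unit_itv : set (measurableTypeR R) := `[0, 1[%classic.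
Definition half_line : set (measurableTypeR R) := `[0, +oo[%classic.

Lemma measurable_unit_itv : measurable unit_itv.
Proof. exact: measurable_itv. Qed.

Lemma measurable_half_line : measurable half_line.
Proof. exact: measurable_itv. Qed.

Section LacunaryTargets.
Context d (T : measurableType d).
Variables (mu : {measure set T -> \bar R}) (p : R).
Hypothesis p1 : 1 < p.
Variables (D : nat -> set T) (G : set (set T)).
Hypothesis mD : forall k, measurable (D k).
Hypothesis Doo : forall k, (mu (D k) < +oo)%E.
Hypothesis tD : trivIset setT D.
Hypothesis covD : \bigcup_k D k = setT.
Hypothesis GE : measurable = <<s G >>.
Hypothesis GI : setI_closed G.
Variables (N : nat -> nat) (delta : nat -> R) (A : nat -> nat -> set T).
Hypothesis delta0 : forall j, 0 < delta j.
Hypothesis mA : forall j i, measurable (A j i).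
Hypothesis tA : forall j i i' x, A j i x -> A j i' x -> i = i'.
Hypothesis muA : forall j i, (i < N j)%N -> mu (A j i) = (delta j)%:E.
Hypothesis GA : forall k S, G S \/ S = setT -> \forall j \near \oo,
  exists P : pred nat,
    D k `&` S = \big[setU/set0]_(i < N j | P i) A j i.

(** Counting measure allows no small blocks, so the scales grow: level [j] fills the integers from
    [block_scale N j] up to, but excluding, [block_scale N j.+1]. *)
Lemma complemented_in_ell : complemented (weakLp mu p) (weak_ell p).
Proof.
pose a j : R := (block_scale N j)%:R.
have a0 j : 0 < a j by rewrite ltr0n block_scale_gt0.
have aS j : a j.+1 = a j * (N j).+1%:R by rewrite /a block_scaleS natrM.
pose A' j i : set nat := [set n | a j * i.+1%:R <= n%:R < a j * i.+2%:R].
apply: (complemented_of_blocks p1 mD Doo tD covD GE GI delta0 mA tA muA GA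
  (a := a) (A' := A')) => //.
- move=> j i j' i' n iN iN' h h'; apply: (blocks_disjoint a0 _ iN iN' h h').
  move=> k k' kk'; left; rewrite -aS ler_nat; exact: block_scale_le.
- move=> j i iN; rewrite -(counting_itv (block_scale N j * i.+1)).
  congr counting; apply/seteqP; split => n /=;
    by rewrite /A' /a /= -!natrM ler_nat ltr_nat addnC -mulnS.
- exact: lacunary_increasing.
Qed.

(** The total measure is 1, so the scales shrink: level [j] fills the interval between the inverses
    of [block_scale N j.+1] and [block_scale N j]. *)
Lemma complemented_in_unit_itv :
  complemented (weakLp mu p) (weakLp (lebesgue_on measurable_unit_itv) p).
Proof.
pose a j : R := ((block_scale N j.+1)%:R)^-1.
have b0 j : 0 < (block_scale N j)%:R :> R by rewrite ltr0n block_scale_gt0.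
have a0 j : 0 < a j by rewrite invr_gt0.
have aN j : a j * (N j).+1%:R = ((block_scale N j)%:R)^-1.
  by rewrite /a block_scaleS natrM invfM mulfVK.
pose A' j i : set (measurableTypeR R) := `[a j * i.+1%:R, a j * i.+2%:R[%classic.
have A'E j i x : A' j i x -> a j * i.+1%:R <= x < a j * i.+2%:R.
  by rewrite /A' /= in_itv.
apply: (complemented_of_blocks p1 mD Doo tD covD GE GI delta0 mA tA muA GA
  (a := a) (A' := A')) => //.
- by move=> j i; exact: measurable_itv.
- move=> j i j' i' n iN iN' /A'E h /A'E h'; apply: (blocks_disjoint a0 _ iN iN' h h').
  move=> k k' kk'; right; rewrite aN lef_pV2 ?posrE// ler_nat.
  exact: block_scale_le.
- move=> j i iN; rewrite /lebesgue_on /= /mrestr setIidl.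
    rewrite [LHS]lebesgue_measure_itv/= lte_fin ltr_pM2l// ltr_nat ltnSn.
    by rewrite -EFinB -mulrBr -natrB// subSnn mulr1.
  move=> x /A'E /andP[lo hi]; rewrite /unit_itv /= in_itv/=.
  rewrite (le_trans _ lo) ?mulr_ge0 ?(ltW (a0 j))//=.
  apply: lt_le_trans hi _.
  apply: (@le_trans _ _ (a j * (N j).+1%:R)); first by rewrite ler_pM2l// ler_nat.
  by rewrite aN invf_le1// ler1n block_scale_gt0.
- by apply: lacunary_decreasing => // j; rewrite aN.
Qed.

End LacunaryTargets.

(** Infinitely many disjoint blocks of equal measure do not fit into [0, 1), so level [j] copies
    only the points 0, ..., [j]; every point is an atom of all large levels. *)
Lemma ell_complemented_in_unit_itv (p : R) : 1 < p ->
  complemented (weak_ell p) (weakLp (lebesgue_on measurable_unit_itv) p).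
Proof.
move=> p1; pose D k : set nat := [set k].
pose G : set (set nat) := [set S | is_subset1 S].
apply: (@complemented_in_unit_itv _ nat (@counting nat R) p p1 D G _ _ _ _ _ _
  succn (fun=> 1) (fun _ i => [set i])) => //.
- by move=> k; rewrite [X in (X < _)%E]counting_set1 ltry.
- by move=> i j _ _ [n [/= <- <-]].
- by apply/seteqP; split => // n _; exists n.
- apply/seteqP; split => // S _.
  rewrite (_ : S = \bigcup_n (S `&` [set n])).
    have [_ _ UG] := smallest_sigma_algebra setT G; apply: UG => n.
    by apply: sub_gen_smallest => x y [_ ->] [_ ->].
  by rewrite -setI_bigcupr; apply/esym/setIidPl => n _; exists n.
- by move=> S S' s _ x y [Sx _] [Sy _]; exact: s.
- by move=> _ i i' n /= -> ->.
- by move=> _ i _; exact: counting_set1.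
- move=> k S _; exists k.+1 => // j /= kj.
  exists (fun i => (i == k) && `[< S k >]); apply/seteqP; split => n.
    move=> [/= -> Sk]; apply/bigsetU_condP.
    by exists (Ordinal (leqW kj)) => //=; rewrite eqxx; apply/asboolP.
  by move=> /bigsetU_condP[i /andP[/eqP ik /asboolP Sk]] /= ->; rewrite ik.
Qed.

End SequenceAndUnitInterval.

(** * The half-line embeds in sequences *)

Section ItvType.
Context {R : realType}.

Lemma measurable_itv_preimage (I : interval R) (Ine : [set` I] !=set0)
    (B : set (measurableTypeR R)) : measurable B ->
  measurable ((@itv_val R _ Ine) @^-1` B : set (itvType Ine)).
Proof. by move=> mB; exists B; rewrite ?setTI. Qed.

Lemma itv_lebesgue_measure_preimage (I : interval R) (Ine : [set` I] !=set0)
    (B : set R) :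
  itv_lebesgue_measure ((@itv_val R _ Ine) @^-1` B : set (itvType Ine)) =
  lebesgue_measure (B `&` [set` I]).
Proof.
rewrite /itv_lebesgue_measure; congr lebesgue_measure; apply/seteqP; split=> x.
  by move=> [y By <-]; split => //; exact: (svalP y).
by move=> [Bx Ix]; exists (exist _ x Ix).
Qed.

End ItvType.

Section HalfLine.
Context {R : realType}.
Local Notation I0 := (itv0y_neq0 R).
Local Notation T := (itvType I0).
Local Notation ival := (@itv_val R _ I0).

Lemma half_line_ge0 (x : T) : 0 <= ival x.
Proof. by have := svalP x; rewrite in_itv/= andbT. Qed.

Definition dyadic_index j (x : T) : nat := Num.truncn (2 ^+ j * ival x).

Lemma dyadic_index_ge j (x : T) m :
  (m <= dyadic_index j x)%N = (2 ^- j * m%:R <= ival x).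
Proof.
have t0 : 0 < 2 ^+ j :> R by rewrite exprn_gt0.
rewrite /dyadic_index truncn_ge_nat ?mulr_ge0 ?half_line_ge0 ?(ltW t0)//.
by rewrite ler_pdivrMl.
Qed.

Lemma dyadic_indexP j (x : T) i : dyadic_index j x = i <->
  2 ^- j * i%:R <= ival x < 2 ^- j * i.+1%:R.
Proof.
split=> [<-|/andP[]].
  by rewrite -dyadic_index_ge leqnn ltNge -dyadic_index_ge ltnn.
rewrite -dyadic_index_ge ltNge -dyadic_index_ge -ltnNge ltnS => h1 h2.
by apply/eqP; rewrite eqn_leq h1 h2.
Qed.

Lemma dyadic_rescale l j (n : R) : (l <= j)%N ->
  2 ^- j * (n * 2 ^+ (j - l)) = 2 ^- l * n.
Proof.
move=> lj; rewrite -[in 2 ^- j](subnK lj) exprD invfM mulrACA mulrC -mulrA.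
by rewrite mulVKf// expf_neq0.
Qed.

Lemma dyadic_index_div l j (x : T) : (l <= j)%N ->
  dyadic_index l x = (dyadic_index j x %/ 2 ^ (j - l))%N.
Proof.
move=> lj; apply/eqP; rewrite eqn_leq; apply/andP; split.
  rewrite leq_divRL ?expn_gt0// dyadic_index_ge natrM natrX dyadic_rescale//.
  by rewrite -dyadic_index_ge.
rewrite dyadic_index_ge -(dyadic_rescale _ lj) -[2 ^+ (j - l)]natrX -natrM.
rewrite -dyadic_index_ge.
exact: leq_trunc_div.
Qed.

Let atom j i := [set x : T | dyadic_index j x = i].
Let ray l m := [set x : T | (m <= dyadic_index l x)%N].
(** A generating pi-system whose members, cut by a unit interval, are unions of atoms at every level
    from some level on. *)
Let rays : set (set T) := [set S | exists l m, S = ray l m].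

Let atomE j i : atom j i =
  ival @^-1` `[2 ^- j * i%:R, 2 ^- j * i.+1%:R[%classic.
Proof.
by apply/seteqP; split => x; rewrite /atom /= in_itv/=; [move/dyadic_indexP|move=> ?; apply/dyadic_indexP].
Qed.

Let measurable_atom j i : measurable (atom j i).
Proof. by rewrite atomE; apply: measurable_itv_preimage; exact: measurable_itv. Qed.

Let measure_atom j i : itv_lebesgue_measure (atom j i) = (2 ^- j)%:E.
Proof.
have t0 : 0 < 2 ^- j :> R by rewrite invr_gt0 exprn_gt0.
rewrite atomE itv_lebesgue_measure_preimage setIidl; last first.
  move=> x; rewrite /= !in_itv/= andbT => /andP[+ _]; apply: le_trans.
  by rewrite mulr_ge0// ltW.
rewrite lebesgue_measure_itv/= lte_fin ltr_pM2l// ltr_nat ltnSn -EFinB -mulrBr.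
by rewrite -natrB// subSnn mulr1.
Qed.

Let ray0 : ray 0 0 = setT. Proof. by apply/seteqP; split. Qed.

Let rays_setI : setI_closed rays.
Proof.
move=> _ _ [l [m ->]] [l' [m' ->]].
have [h|h] := leP (2 ^- l * m%:R : R) (2 ^- l' * m'%:R).
  exists l', m'; apply/seteqP; split => x; first by case.
  rewrite /ray /= !dyadic_index_ge => h'; split => //=.
  exact: le_trans h h'.
exists l, m; apply/seteqP; split => x; first by case.
rewrite /ray /= !dyadic_index_ge => h'; split => //=.
exact: le_trans (ltW h) h'.
Qed.

Let rays_generate : @measurable _ T = <<s rays >>.
Proof.
apply/seteqP; split; last first.
  apply: smallest_sub; first exact: sigma_algebra_measurable.
  move=> _ [l [m ->]].
  rewrite (_ : ray l m = ival @^-1` `[2 ^- l * m%:R, +oo[%classic).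
    by apply: measurable_itv_preimage; exact: measurable_itv.
  by apply/seteqP; split => x; rewrite /ray /= dyadic_index_ge in_itv/= andbT.
have [s0 sC sU] := smallest_sigma_algebra setT rays.
have rayin l m : <<s rays >> (ray l m).
  by apply: sub_gen_smallest; exists l, m.
pose Sg := [set B : set R | <<s rays >> (ival @^-1` B : set T)].
have sub : <<s (@RGenOInfty.G R) >> `<=` Sg.
  apply: smallest_sub.
    split.
    - by rewrite /Sg /= preimage_set0.
    - by move=> B SB; rewrite /Sg /= setTD preimage_setC -setTD; exact: sC.
    - by move=> F SF; rewrite /Sg /= preimage_bigcup; exact: sU.
  move=> _ [y ->]; rewrite /Sg /=.
  (* For [y < 0] the truncation is 0 and the union used below would miss the point 0. *)
  have [y0|y0] := leP 0 y; last first.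
    rewrite (_ : _ @^-1` _ = ray 0 0); first exact: rayin.
    rewrite ray0; apply/seteqP; split => // x _; rewrite /= in_itv/= andbT.
    exact: lt_le_trans y0 (half_line_ge0 x).
  rewrite (_ : _ @^-1` _ = \bigcup_l ray l (Num.truncn (2 ^+ l * y)).+1); last first.
    apply/seteqP; split => x; rewrite /= in_itv/= andbT; last first.
      move=> [l _]; rewrite /ray /= dyadic_index_ge; apply: lt_le_trans.
      by rewrite ltr_pdivlMl ?exprn_gt0// truncnS_gt.
    move=> yx; have xy0 : 0 < ival x - y by rewrite subr_gt0.
    pose l := Num.bound (ival x - y)^-1; exists l => //.
    have t0 : 0 < 2 ^+ l :> R by rewrite exprn_gt0.
    rewrite /ray /= dyadic_index_ge ler_pdivrMl// -natr1.
    have l1 : 1 <= 2 ^+ l * (ival x - y).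
      rewrite -ler_pdivrMr// mul1r; apply: ltW.
      apply: lt_le_trans (archi_boundP _) _; first by rewrite invr_ge0 ltW.
      by rewrite -natrX ler_nat ltnW// ltn_expl.
    rewrite mulrBr lerBrDr in l1; apply: le_trans l1; rewrite addrC lerD2l.
    by rewrite truncn_le mulr_ge0// ltW.
  by apply: sU => l; exact: rayin.
move=> S [B mB <-]; rewrite setTI; apply: sub.
suff : (@RGenOInfty.G R).-sigma.-measurable B by [].
by rewrite -RGenOInfty.measurableE; exact: mB.
Qed.

Lemma half_line_complemented_in_ell (p : R) : 1 < p ->
  complemented (weakLp_itv I0 p) (weak_ell p).
Proof.
move=> p1.
apply: (@complemented_in_ell _ _ T (@itv_lebesgue_measure R _ I0) p p1
  (atom 0) rays _ _ _ _ rays_generate rays_setI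
  (fun j => 2 ^ j * 2 ^ j)%N (fun j => 2 ^- j) atom) => //.
- by move=> k; rewrite [X in (X < _)%E]measure_atom ltry.
- by move=> i j _ _ [x [/= <- <-]].
- by apply/seteqP; split => // x _; exists (dyadic_index 0 x).
- by move=> j i i' x /= <- <-.
- by move=> j i _; exact: measure_atom.
- move=> k S GS; have [l [m ->]] : exists l m, S = ray l m.
    by case: GS => [//|->]; exists 0%N, 0%N; rewrite ray0.
  (* From level [l] on the atoms refine the ray, and [k < j] puts the unit interval at [k] inside
     [0, 2^j), which the atoms of level [j] cover. *)
  exists (maxn l k.+1) => // j /=; rewrite geq_max => /andP[lj kj].
  exists (fun i => (i %/ 2 ^ j == k) && (m <= i %/ 2 ^ (j - l)))%N.
  apply/seteqP; split => x.
    move=> [xk xm]; apply/bigsetU_condP.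
    have jk : (dyadic_index j x %/ 2 ^ j)%N = k.
      by rewrite -xk (@dyadic_index_div 0 j)// subn0.
    have jN : (dyadic_index j x < 2 ^ j * 2 ^ j)%N.
      by rewrite -ltn_divLR ?expn_gt0// jk (leq_trans kj)// ltnW// ltn_expl.
    exists (Ordinal jN) => //=; rewrite jk eqxx/=.
    by rewrite -dyadic_index_div.
  move=> /bigsetU_condP[i /andP[/eqP ik im]] xi; split.
    by rewrite /atom /= (@dyadic_index_div 0 j)// subn0 xi.
  by rewrite /ray /= (dyadic_index_div x lj) xi.
Qed.

End HalfLine.

(** * Squares and changes of interval *)

Section RealLine.
Context {R : realType}.
Local Notation lambda := (@lebesgue_measure R).

Lemma measurable_affine (a b : R) :
  measurable_fun setT (fun x : measurableTypeR R => a * x + b : measurableTypeR R).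
Proof. by apply: measurable_funD => //; exact: measurable_funM. Qed.

(** By uniqueness of Lebesgue measure: [a] times the pushforward has the right value on half-open
    intervals. *)
Lemma lebesgue_measure_affine (a b : R) (B : set (measurableTypeR R)) :
  0 < a -> measurable B ->
  lambda ((fun x => a * x + b) @^-1` B) = (a^-1%:E * lambda B)%E.
Proof.
move=> a0 mB; pose f (x : measurableTypeR R) : measurableTypeR R := a * x + b.
have mf : measurable_fun setT f by exact: measurable_affine.
have [m mE] : exists m : {measure set (measurableTypeR R) -> \bar R},
    forall A, m A = lambda (f @^-1` A).
  by unshelve eexists (pushforward lambda f : {measure set (measurableTypeR R) -> \bar R}).
have U : lambda B = (a%:E * m B)%E.
  apply: (@lebesgue_measure_unique _ (mscale (NngNum (ltW a0)) m)) => //.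
  move=> _ [[x y] _ <-] /=; transitivity (a%:E * m `]x, y]%classic)%E => //.
  rewrite mE.
  rewrite (_ : f @^-1` _ = `](x - b) / a, (y - b) / a]%classic); last first.
    apply/seteqP; split => z; rewrite /f /= !in_itv/= ltr_pdivrMr// ler_pdivlMr//;
      by rewrite ltrBlDr lerBrDr (mulrC z).
  rewrite !lebesgue_measure_itv/= !lte_fin ltr_pM2r ?invr_gt0// ltrD2r.
  case: ifP => _; last by rewrite mule0.
  by rewrite -!EFinB -EFinM; congr (_%:E); field; exact: lt0r_neq0.
rewrite U mE muleA -EFinM mulVf ?mul1e//.
exact: lt0r_neq0.
Qed.

(* [phi] is affine with slope [a] on countably many pieces of [J `&` E], which
   it maps into disjoint subsets [Q k] of [J]. *)
Lemma lebesgue_on_piecewise_affine (J : set (measurableTypeR R))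
    (mJ : measurable J) (E : set (measurableTypeR R)) (a : R) (b : nat -> R)
    (Q : nat -> set (measurableTypeR R))
    (phi : measurableTypeR R -> measurableTypeR R) :
  0 < a -> measurable E -> measurable_fun setT phi ->
  (forall k, measurable (Q k)) -> trivIset setT Q -> (forall k, Q k `<=` J) ->
  (forall x, J x -> E x -> exists2 k, phi x = a * x + b k & Q k (phi x)) ->
  forall B, measurable B ->
    (lebesgue_on mJ (E `&` phi @^-1` B) <= a^-1%:E * lebesgue_on mJ B)%E.
Proof.
move=> a0 mE mphi mQ tQ QJ phiE B mB.
pose F k := (fun x => a * x + b k) @^-1` (B `&` Q k).
have mBQ k : measurable (B `&` Q k) by exact: measurableI.
have mF k : measurable (F k).
  by rewrite -[X in measurable X]setTI; exact: measurable_affine.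
have mphiB : measurable (phi @^-1` B).
  by rewrite -[X in measurable X]setTI; exact: mphi.
rewrite /lebesgue_on /= /mrestr.
apply: (@le_trans _ _ (lambda (\bigcup_k F k))).
  apply: le_measure; rewrite ?inE.
  - by apply: measurableI => //; exact: measurableI.
  - exact: bigcupT_measurable.
  move=> x [[Ex Bx] Jx]; have [k e Qx] := phiE x Jx Ex.
  by exists k => //; rewrite /F /= -e.
apply: le_trans (@generalized_Boole_inequality _ _ _ lambda F mF
  (bigcupT_measurable F mF)) _.
have -> : (\sum_(0 <= k <oo) lambda (F k) =
    \sum_(0 <= k <oo) (a^-1%:E * lambda (B `&` Q k)))%E.
  by apply: eq_eseriesr => k _; exact: lebesgue_measure_affine.
rewrite nneseriesZl//; apply: lee_wpmul2l; first by rewrite lee_fin invr_ge0 ltW.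
rewrite -measure_semi_bigcup//; last 2 first.
- apply/trivIsetP => i j _ _ ij; rewrite setIACA.
  by move/trivIsetP : tQ => /(_ i j Logic.I Logic.I ij) ->; rewrite setI0.
- exact: bigcupT_measurable.
apply: le_measure; rewrite ?inE; first exact: bigcupT_measurable.
  exact: measurableI.
by move=> x [k _ [Bx /QJ Jx]].
Qed.

End RealLine.

Section Transfer.
Context {R : realType}.
Local Notation lambda := (@lebesgue_measure R).

Lemma lebesgue_on_ae (J : set (measurableTypeR R)) (mJ : measurable J)
    (P : R -> Prop) : (forall x, J x -> P x) ->
  {ae lebesgue_on mJ, forall x, P x}.
Proof.
move=> JP; exists (~` J); split; first exact: measurableC.
  by rewrite /lebesgue_on /= /mrestr setICl measure0.
by move=> x /= nP Jx; apply: nP; exact: JP.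
Qed.

(** Passes from the subtype to the line with a restricted measure. [J] may miss a null part of the
    interval, which replaces [0, 1] by [0, 1), a set that halves exactly. *)
Lemma itv_homeomorphic (I : interval R) (Ine : [set` I] !=set0)
    (J : set (measurableTypeR R)) (mJ : measurable J) (p : R) : 1 < p ->
  J `<=` [set` I] -> lambda ([set` I] `\` J) = 0%E ->
  linearly_homeomorphic (weakLp_itv Ine p) (weakLp (lebesgue_on mJ) p).
Proof.
move=> p1 JI IJ0; have [x0 Ix0] := Ine.
pose psi (x : measurableTypeR R) : itvType Ine :=
  if pselect (x \in I) is left Ix then exist _ x Ix else exist _ x0 Ix0.
pose phi (x : itvType Ine) : measurableTypeR R := @itv_val R _ Ine x.
have phiK : cancel phi psi.
  move=> x; apply: itv_val_inj; rewrite /psi; case: pselect => // nI.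
  by have := svalP x.
have psiK x : x \in I -> phi (psi x) = x.
  by move=> Ix; rewrite /psi; case: pselect.
have mI : measurable ([set` I] : set (measurableTypeR R)) by exact: measurable_itv.
have mphi : measurable_fun setT phi.
  by move=> _ B mB; rewrite setTI; exact: measurable_itv_preimage.
have mpsi : measurable_fun setT psi.
  move=> _ _ [B mB <-]; rewrite !setTI.
  have -> : psi @^-1` ((@itv_val R _ Ine) @^-1` B) =
      ([set` I] `&` B) `|` (~` [set` I] `&` [set x | B x0]).
    apply/seteqP; split => x /=; rewrite /psi; case: pselect => //= Ix.
    - by left.
    - by right.
    - by move=> [[_ //]|[//]].
    - by move=> [[//]|[_ //]].
  apply: measurableU; first exact: measurableI.
  apply: measurableI; first exact: measurableC.
  have [Bx|Bx] := pselect (B x0).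
    by rewrite (_ : [set _ | _] = setT)//; apply/seteqP; split.
  by rewrite (_ : [set _ | _] = set0)//; apply/seteqP; split.
have mIJ : measurable ([set` I] `\` J) by exact: measurableD.
have bpsi B : measurable B ->
    (lebesgue_on mJ (setT `&` psi @^-1` B) <= 1%:E * itv_lebesgue_measure B)%E.
  move=> mB; rewrite mul1e setTI; apply: le_measure; rewrite ?inE.
  - by apply: measurableI => //; rewrite -[X in measurable X]setTI; exact: mpsi.
  - exact: measurable_itv_val.
  by move=> x [/= Bx Jx]; exists (psi x) => //; apply: psiK; exact: JI.
have bphi B : measurable B ->
    (itv_lebesgue_measure (setT `&` phi @^-1` B) <= 1%:E * lebesgue_on mJ B)%E.
  move=> mB; rewrite mul1e setTI itv_lebesgue_measure_preimage//.
  apply: (@le_trans _ _ (lambda ((B `&` J) `|` ([set` I] `\` J)))).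
    apply: le_measure; rewrite ?inE.
    - exact: measurableI.
    - by apply: measurableU => //; exact: measurableI.
    by move=> x [Bx Ix]; have [Jx|nJx] := pselect (J x); [left|right].
  have := @measureU2 _ _ _ lambda _ _ (measurableI _ _ mB mJ) mIJ.
  by move/le_trans; apply; rewrite [X in (_ + X)%E](IJ0 : lambda _ = _) adde0.
have [|A [B [cA cB AB BA]]] := complemented_of_maps p1 ltr01 mpsi mphi
  measurableT measurableT bpsi bphi.
  by apply: aeW => x; split => //; exact: phiK.
exists A, B; split => //; apply: BA; apply: lebesgue_on_ae => x Jx; split => //.
by apply: psiK; exact: JI.
Qed.

End Transfer.

Section Splitting.
Context {R : realType}.
Local Notation lambda := (@lebesgue_measure R).

Lemma lebesgue_on_affine (J : set (measurableTypeR R)) (mJ : measurable J)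
    (E : set (measurableTypeR R)) (a b c : R)
    (phi : measurableTypeR R -> measurableTypeR R) :
  0 < a -> a^-1 <= c -> measurable E ->
  (forall x, phi x = a * x + b) -> (forall x, J x -> E x -> J (phi x)) ->
  forall B, measurable B ->
    (lebesgue_on mJ (E `&` phi @^-1` B) <= c%:E * lebesgue_on mJ B)%E.
Proof.
move=> a0 ac mE phiE JE B mB.
have mphi : measurable_fun setT phi.
  by rewrite (_ : phi = (fun x => a * x + b)); [exact: measurable_affine|exact/funext].
have := @lebesgue_on_piecewise_affine R J mJ E a (fun=> b)
  (fun k => if k is 0 then J else set0) phi a0 mE mphi.
move=> /(_ _ _ _ _ B mB)/le_trans; apply.
- by case.
- by apply/trivIsetP => -[|i] [|j] //= _ _ _; rewrite ?setI0 ?set0I.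
- by move=> [|k] x.
- by move=> x Jx Ex; exists 0%N; [rewrite phiE|exact: JE].
- by apply: lee_wpmul2r => //; rewrite lee_fin.
Qed.

Lemma unit_itv_square (p : R) : 1 < p ->
  linearly_homeomorphic (weakLp (lebesgue_on (@measurable_unit_itv R)) p)
    (weakLp (lebesgue_on (@measurable_unit_itv R)) p *
     weakLp (lebesgue_on (@measurable_unit_itv R)) p)%type.
Proof.
move=> p1; pose E : set (measurableTypeR R) := `[0, 2^-1[%classic.
have mE : measurable E by exact: measurable_itv.
have mEC : measurable (~` E) by exact: measurableC.
have inJ (x : R) : unit_itv x <-> is_true (0 <= x < 1) by rewrite /unit_itv /= in_itv.
have inE' (x : R) : E x <-> is_true (0 <= x < 2^-1) by rewrite /E /= in_itv.
apply: (@square_of_splitting R _ _ (lebesgue_on (@measurable_unit_itv R)) p 2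
  (fun x => 2^-1 * x + 0) (fun x => 2^-1 * x + 2^-1)
  (fun x => 2 * x + 0) (fun x => 2 * x + -1) E p1) => //.
- exact: measurable_affine.
- exact: measurable_affine.
- exact: measurable_affine.
- exact: measurable_affine.
- move=> B mB; rewrite -[X in lebesgue_on _ X]setTI.
  apply: (@lebesgue_on_affine _ _ setT 2^-1 0) mB => // [|x /inJ x01 _].
    by rewrite invrK.
  by apply/inJ; lra.
- move=> B mB; rewrite -[X in lebesgue_on _ X]setTI.
  apply: (@lebesgue_on_affine _ _ setT 2^-1 2^-1) mB => // [|x /inJ x01 _].
    by rewrite invrK.
  by apply/inJ; lra.
- apply: (@lebesgue_on_affine _ _ E 2 0) => // [|x /inJ x01 /inE' x0].
    by lra.
  by apply/inJ; lra.
- apply: (@lebesgue_on_affine _ _ (~` E) 2 (-1)) => // [|x /inJ x01 nEx].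
    by lra.
  have [x2|x2] := ltP x 2^-1; last by apply/inJ; lra.
  by case: nEx; apply/inE'; lra.
- apply: lebesgue_on_ae => x /inJ x01; split; last by lra.
  by apply/inE'; lra.
- apply: lebesgue_on_ae => x /inJ x01; split; last by lra.
  by move=> /inE'; lra.
- by apply: lebesgue_on_ae => x /inJ x01; split => _; lra.
Qed.

Lemma truncn_add (x : R) n : 0 <= x ->
  Num.truncn (x + n%:R) = (Num.truncn x + n)%N.
Proof.
move=> /truncn_itv/andP[h1 h2]; apply: truncn_def.
by rewrite -addSn !natrD lerD2r ltrD2r h1 h2.
Qed.

Lemma truncn_sub (x : R) n : (n <= Num.truncn x)%N -> 0 <= x ->
  Num.truncn (x - n%:R) = (Num.truncn x - n)%N.
Proof.
move=> nx x0; have xn : 0 <= x - n%:R by rewrite subr_ge0 -truncn_ge_nat.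
by rewrite -{2}(subrK n%:R x) truncn_add// addnK.
Qed.

Lemma measurable_truncn_comp (g : nat -> R) :
  measurable_fun setT (fun x : measurableTypeR R => g (Num.truncn (x : R)) : measurableTypeR R).
Proof.
move=> _ Y mY; rewrite setTI.
have -> : (fun x : R => g (Num.truncn x)) @^-1` Y =
    \bigcup_(k in [set k | Y (g k)]) [set x | Num.truncn x = k].
  apply/seteqP; split => x /=; first by move=> h; exists (Num.truncn x).
  by move=> [k /= h e]; rewrite e.
apply: bigcup_measurable => k _.
have mle n : measurable ([set x | (Num.truncn x <= n)%N] : set (measurableTypeR R)).
  rewrite (_ : [set _ | _] = `]-oo, n.+1%:R[%classic); first exact: measurable_itv.
  by apply/seteqP; split => x /=; rewrite truncn_le_nat in_itv.
case: k => [|k].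
  rewrite (_ : [set _ | _] = [set x | (Num.truncn x <= 0)%N])//.
  by apply/seteqP; split => x /=; rewrite leqn0 => /eqP.
rewrite (_ : [set _ | _] = [set x | (Num.truncn x <= k.+1)%N] `\`
                           [set x | (Num.truncn x <= k)%N]); first exact: measurableD.
apply/seteqP; split => x /=; first by move=> ->; rewrite leqnn ltnn.
by move=> [h /negP]; rewrite -ltnNge => h'; apply/eqP; rewrite eqn_leq h h'.
Qed.

(** The unit interval at [k] is translated to the one at [2k] by [phi0] and to the one at [2k + 1]
    by [phi1]; [E] consists of the points with even integer part. *)
Lemma half_line_square (p : R) : 1 < p ->
  linearly_homeomorphic (weakLp (lebesgue_on (@measurable_half_line R)) p)
    (weakLp (lebesgue_on (@measurable_half_line R)) p *
     weakLp (lebesgue_on (@measurable_half_line R)) p)%type.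
Proof.
move=> p1; pose E : set (measurableTypeR R) := [set x | ~~ odd (Num.truncn (x : R))].
have inJ (x : R) : half_line x <-> is_true (0 <= x) by rewrite /half_line /= in_itv/= andbT.
have mE : measurable E.
  pose g n : R := (odd n)%:R.
  have := measurable_truncn_comp g measurableT (measurable_set1 0).
  rewrite setTI; congr measurable; apply/seteqP; split => x /=; rewrite /g /E /=;
    by case: odd => //= /eqP; rewrite oner_eq0.
have mEC : measurable (~` E) by exact: measurableC.
pose unit k : set (measurableTypeR R) := `[k%:R, k.+1%:R[%classic.
have unitP k x : 0 <= x -> Num.truncn x = k -> unit k x.
  by move=> x0 <-; rewrite /unit /= in_itv; exact: truncn_itv.
have unitJ k : unit k `<=` half_line.
  move=> x; rewrite /unit /= in_itv/= => /andP[h _]; apply/inJ.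
  exact: le_trans h.
have tunit : trivIset setT unit.
  move=> i j _ _ [x]; rewrite /unit /= !in_itv/= => -[h h'].
  by rewrite -(truncn_def h) -(truncn_def h').
have munit k : measurable (unit k) by exact: measurable_itv.
pose shift (g : nat -> R) (x : measurableTypeR R) : measurableTypeR R :=
  x + g (Num.truncn (x : R)).
have mtr (g : nat -> R) : measurable_fun setT
    (shift g).
  by apply: measurable_funD => //; exact: measurable_truncn_comp.
(* [b k] is the translation on the piece [k], and [s k] the unit interval it is moved into; for the
   inverse maps [k] is half the integer part, rounded down. *)
have bound (F : set (measurableTypeR R)) (g b : nat -> R) (s : nat -> nat) :
    measurable F -> injective s ->
    (forall x : R, 0 <= x -> F x -> exists k, [/\ g (Num.truncn x) = b k,
       0 <= x + b k & Num.truncn (x + b k) = s k]) ->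
    forall B, measurable B ->
    (lebesgue_on (@measurable_half_line R)
       (F `&` shift g @^-1` B) <=
     1%:E * lebesgue_on (@measurable_half_line R) B)%E.
  move=> mF sinj H B mB; rewrite -[in leRHS](invr1 R).
  apply: (@lebesgue_on_piecewise_affine R _ _ F 1 b (fun k => unit (s k))) mB => //.
  - by move=> i j _ _ ss; apply: sinj; exact: tunit ss.
  - by move=> x /inJ x0 /(H x x0) [k [e h1 h2]]; exists k; rewrite /shift e ?mul1r//; exact: unitP.
have even_half n : ~~ odd n -> (n./2 <= n)%N /\ (n - n./2 = n./2)%N.
  move=> /negbTE od; have e := odd_double_half n; rewrite od add0n in e.
  by rewrite -[X in (_ <= X)%N]e -[X in (X - _)%N]e -addnn leq_addl addnK.
have odd_half n : odd n -> (n./2 < n)%N /\ (n - n./2.+1 = n./2)%N.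
  move=> od; have e := odd_double_half n; rewrite od add1n in e.
  by rewrite -[X in (_ < X)%N]e -[X in (X - _)%N]e ltnS -addnn leq_addl subSS addnK.
apply: (@square_of_splitting R _ _ (lebesgue_on (@measurable_half_line R)) p 1
  (fun x => x + (Num.truncn x)%:R) (fun x => x + (Num.truncn x).+1%:R)
  (fun x => x + - (Num.truncn x)./2%:R)
  (fun x => x + - (Num.truncn x)./2.+1%:R) E p1) => //.
- exact: (mtr (fun n => n%:R)).
- exact: (mtr (fun n => n.+1%:R)).
- exact: (mtr (fun n => - n./2%:R)).
- exact: (mtr (fun n => - n./2.+1%:R)).
- move=> B mB; rewrite -[X in lebesgue_on _ X]setTI.
  apply: (bound _ (fun n => n%:R) (fun n => n%:R) double) mB => //.
    exact: double_inj.
  move=> x x0 _; exists (Num.truncn x); split => //; first by rewrite addr_ge0.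
  by rewrite truncn_add// addnn.
- move=> B mB; rewrite -[X in lebesgue_on _ X]setTI.
  apply: (bound _ (fun n => n.+1%:R) (fun n => n.+1%:R) (fun n => n.*2.+1)) mB => //.
    by move=> i j [] /double_inj.
  move=> x x0 _; exists (Num.truncn x); split => //; first by rewrite addr_ge0.
  by rewrite truncn_add// addnS addnn.
- apply: (bound _ (fun n => - n./2%:R) (fun n => - n%:R) id) => //.
  move=> x x0; rewrite /E /= => /even_half[h e]; exists (Num.truncn x)./2; split => //.
    by rewrite subr_ge0 -truncn_ge_nat.
  by rewrite truncn_sub.
- apply: (bound _ (fun n => - n./2.+1%:R) (fun n => - n.+1%:R) id) => //.
  move=> x x0; rewrite /E /= => /negP/negPn/odd_half[h e].
  exists (Num.truncn x)./2; split => //; first by rewrite subr_ge0 -truncn_ge_nat.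
  by rewrite truncn_sub.
- apply: lebesgue_on_ae => x /inJ x0; rewrite /E /= truncn_add// addnn odd_double.
  by rewrite doubleK addrK.
- apply: lebesgue_on_ae => x /inJ x0; rewrite /E /= truncn_add// addnS addnn /=.
  by rewrite odd_double/= uphalf_double addrK.
- apply: lebesgue_on_ae => x /inJ x0; rewrite /E /=.
  by split => [/even_half|/negP/negPn/odd_half] [h e]; rewrite truncn_sub// e subrK.
Qed.

End Splitting.

Section Discrete.
Context {R : realType}.

Lemma counting_preimage_injective (F B : set nat) (phi : nat -> nat) :
  {in F &, injective phi} ->
  (@counting nat R (F `&` phi @^-1` B) <= 1%:E * @counting nat R B)%E.
Proof.
move=> phiI; rewrite mul1e; set A := F `&` _.
have AB : (A #<= B)%card.
  have phiA : {in A &, injective phi}.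
    by move=> i j; rewrite !inE => -[Fi _] [Fj _]; apply: phiI; rewrite inE.
  rewrite -(card_le_eql (inj_card_eq phiA)).
  by apply: subset_card_le => _ [i [_ Bi] <-].
rewrite /counting; case: (asboolP (finite_set B)) => finB; last exact: leey.
have finA := card_le_finite AB finB; rewrite asboolT// lee_fin ler_nat.
have [[m Bm] [n An]] := (finB, finA).
rewrite (card_fset_set Bm) (card_fset_set An) -card_le_II.
by rewrite -(card_le_eql An) -(card_le_eqr Bm).
Qed.

Lemma ell_square (p : R) : 1 < p ->
  linearly_homeomorphic (weak_ell p) (weak_ell p * weak_ell p)%type.
Proof.
move=> p1.
have even_half n : ~~ odd n -> n./2.*2 = n.
  by move=> /negbTE od; have := odd_double_half n; rewrite od.
have odd_half n : odd n -> n./2.*2.+1 = n.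
  by move=> od; have := odd_double_half n; rewrite od.
apply: (@square_of_splitting R _ _ (@counting nat R) p 1 double
  (fun n => n.*2.+1) half half [set n | ~~ odd n] p1) => //.
- move=> B _; rewrite -[X in (X <= _)%E]/(counting _) -[X in counting X]setTI.
  by apply: counting_preimage_injective => i j _ _; exact: double_inj.
- move=> B _; rewrite -[X in (X <= _)%E]/(counting _) -[X in counting X]setTI.
  by apply: counting_preimage_injective => i j _ _ [] /double_inj.
- move=> B _; apply: counting_preimage_injective => i j.
  by rewrite !inE /= => /even_half {2}<- /even_half {2}<- ->.
- move=> B _; apply: counting_preimage_injective => i j.
  by rewrite !inE /= => /negP/negPn/odd_half {2}<- /negP/negPn/odd_half {2}<- ->.
- by apply: aeW => n /=; rewrite odd_double doubleK.
- by apply: aeW => n /=; rewrite odd_double /= uphalf_double.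
- by apply: aeW => n /=; split => [/even_half|/negP/negPn/odd_half].
Qed.

End Discrete.

Lemma unit_itv_complemented_in_half_line (R : realType) (p : R) : 1 < p ->
  complemented (weakLp (lebesgue_on (@measurable_unit_itv R)) p)
               (weakLp (lebesgue_on (@measurable_half_line R)) p).
Proof.
move=> p1.
have sub : @unit_itv R `<=` half_line.
  by move=> x; rewrite /unit_itv /half_line /= !in_itv/= => /andP[->].
have [mU mH] : measurable (@unit_itv R) /\ measurable (@half_line R).
  by split; [exact: measurable_unit_itv|exact: measurable_half_line].
have bdd B : measurable B ->
    (lebesgue_on (@measurable_half_line R) (unit_itv `&` id @^-1` B) <=
     1%:E * lebesgue_on (@measurable_unit_itv R) B)%E.
  move=> mB; rewrite mul1e /lebesgue_on /= /mrestr; apply: le_measure; rewrite ?inE.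
  - by apply: measurableI; [exact: measurableI|].
  - exact: measurableI.
  by move=> x [[]].
have bdd' B : measurable B -> (lebesgue_on (@measurable_unit_itv R) (setT `&` id @^-1` B) <=
    1%:E * lebesgue_on (@measurable_half_line R) B)%E.
  move=> mB; rewrite mul1e setTI /lebesgue_on /= /mrestr; apply: le_measure; rewrite ?inE.
  - exact: measurableI.
  - exact: measurableI.
  by move=> x [Bx /sub].
apply: (complemented_of_ae_retraction p1 ltr01 (@measurable_id _ _ setT)
  (@measurable_id _ _ setT) mU measurableT bdd bdd').
exact: lebesgue_on_ae.
Qed.

Theorem theorem1 (R : realType) (p : R) (hp : 1 < p) :
  [/\ linearly_homeomorphic (weak_ell p) (weakLp_itv (itv01_neq0 R) p),
      linearly_homeomorphic (weak_ell p) (weakLp_itv (itv0y_neq0 R) p) &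
      linearly_homeomorphic (weakLp_itv (itv01_neq0 R) p)
                            (weakLp_itv (itv0y_neq0 R) p)].
Proof.
have Y : linearly_homeomorphic (weakLp_itv (itv01_neq0 R) p)
    (weakLp (lebesgue_on (@measurable_unit_itv R)) p).
  apply: itv_homeomorphic => //.
    by move=> x; rewrite /unit_itv /= !in_itv/= => /andP[-> /ltW].
  rewrite (_ : _ `\` _ = [set 1]) ?lebesgue_measure_set1//.
  apply/seteqP; split => x; rewrite /unit_itv /= !in_itv/=; last first.
    by move=> ->; rewrite ler01 lexx ltxx.
  move=> [/andP[x0 x1] /negP]; rewrite x0/= -leNgt => x1'.
  by apply/eqP; rewrite eq_le x1.
have Z : linearly_homeomorphic (weakLp_itv (itv0y_neq0 R) p)
    (weakLp (lebesgue_on (@measurable_half_line R)) p).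
  by apply: itv_homeomorphic => //; rewrite /half_line setDv measure0.
(* The embeddings of [ell] in [0, 1), of [0, 1) in the half-line and of the half-line in [ell] close
   a cycle, which yields all the mutual embeddings. *)
have XY' := ell_complemented_in_unit_itv hp.
have Y'Z' := unit_itv_complemented_in_half_line hp.
have Z'Z := linearly_homeomorphic_complemented (linearly_homeomorphic_sym Z).
have Y'Y := linearly_homeomorphic_complemented (linearly_homeomorphic_sym Y).
have ZX := half_line_complemented_in_ell hp.
have Y'X := complemented_trans Y'Z' (complemented_trans Z'Z ZX).
have YX := complemented_trans (linearly_homeomorphic_complemented Y) Y'X.
have XZ := complemented_trans XY' (complemented_trans Y'Z' Z'Z).
have XX := ell_square hp.
have YY := square_transfer (linearly_homeomorphic_sym Y) (unit_itv_square hp).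
have ZZ := square_transfer (linearly_homeomorphic_sym Z) (half_line_square hp).
have hXY := decomposition (complemented_trans XY' Y'Y) YX XX YY.
have hXZ := decomposition XZ ZX XX ZZ.
split => //.
exact: linearly_homeomorphic_trans (linearly_homeomorphic_sym hXY) hXZ.
Qed.
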